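(* Let $\Sigma\subseteq\mathbb{R}^2$ be open and let $\Omega=\Sigma\times\mathbb{R}$ be equipped with a Riemannian metric $g$ such that $\sup\{\|\nabla_Ye_3\|_\infty: Y\in T^0_{1,c}(\Omega),\ \|Y\|_\infty\le1\}<\infty$, where $e_3=(0,0,1)$ is the constant coordinate vector field. Then for all $\eta\in\mathbb{R}$ with $|\eta|$ small enough, the set $$(1+\eta\mathcal L_{e_3})\big[\Lambda^k(\Omega)\cap\operatorname{dom}(\mathcal L_{e_3})\big]\cap\operatorname{dom}(\mathring d)$$ is dense in $\operatorname{dom}(\mathring d)$ (with respect to the graph norm of $\mathring d$).
   Context: $n=3$, $M=\Omega$ with the smooth metric $g$ and the standard orientation; $\nabla$ is the Levi-Civita connection. $\Lambda^k(\Omega)$ denotes the smooth $k$-forms on $\Omega$, $\Lambda^k_c(\Omega)$ those with compact support, $L_2^k(\Omega)$ the (real) Hilbert space of square-integrable $k$-forms with respect to $g$ and its volume, $\ast$ the Hodge star, and $T^0_{1,c}(\Omega)$ the compactly supported smooth vector fields on $\Omega$. $\mathcal L_{X,c}$ is the Lie derivative along a smooth vector field $X$ with domain $\Lambda_c^k(\Omega)\subseteq L_2^k(\Omega)$ (in every degree), and $\mathcal L_X:=-\ast\mathcal L_{X,c}^*\ast$ as an operator in $L_2^k(\Omega)$. $d_c$ is the exterior derivative with domain $\Lambda_c^k(\Omega)$ as an operator $L_2^k(\Omega)\to L_2^{k+1}(\Omega)$, and $\mathring d:=\overline{d_c}$. In the setting considered, $\mathcal L_{e_3}$ equals $\partial_3$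 up to bounded zeroth-order terms and is quasi-skew-selfadjoint, i.e. $\operatorname{dom}(\mathcal L_{e_3})=\operatorname{dom}(\mathcal L_{e_3}^* )$ and $\mathcal L_{e_3}+\mathcal L_{e_3}^*$ is bounded. *)

(* Defs.v *)
From HB Require Import structures.
From mathcomp Require Import all_boot all_order all_algebra all_fingroup.
From mathcomp Require Import all_classical all_reals all_analysis.

Set Implicit Arguments.
Unset Strict Implicit.
Unset Printing Implicit Defensive.
Import Order.TTheory GRing.Theory Num.Theory.
Import numFieldNormedType.Exports.
Local Open Scope classical_set_scope.
Local Open Scope ring_scope.

(* R^3 is represented as R * R * R, so that Sigma x R is literally
   Sigma `*` setT.  Forms, vector fields and metrics are given by their
   components in the standard chart, as functions on all of R^3; only their
   values on the open set Omega are ever used. *)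

Section Fields.
Context {R : realType}.

Definition lebesgue3 :=
  ((@lebesgue_measure R \x @lebesgue_measure R) \x @lebesgue_measure R)%E.

Definition coord_vec (i : 'I_3) : R * R * R :=
  ((i == 0%N :> nat)%:R, (i == 1%N :> nat)%:R, (i == 2%N :> nat)%:R).

Definition partial (i : 'I_3) (f : R * R * R -> R) : R * R * R -> R :=
  fun x => 'D_(coord_vec i) f x.

(* All iterated partial derivatives exist and are continuous on Omega. *)
Definition smooth (Omega : set (R * R * R)) (f : R * R * R -> R) : Prop :=
  forall (s : seq 'I_3) x, Omega x ->
    {for x, continuous (foldr partial f s)} /\
    forall i, derivable (foldr partial f s) x (coord_vec i).

Definition csupport_in {V : zmodType} (Omega : set (R * R * R))
    (f : R * R * R -> V) : Prop :=
  exists K : set (R * R * R),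
    [/\ compact K, K `<=` Omega & forall x, Omega x -> ~ K x -> f x = 0].

Definition vfield : Type := R * R * R -> 'rV[R]_3.

Definition e3 : vfield := fun=> delta_mx 0 ord_max.

Definition smooth_vfield (Omega : set (R * R * R)) (Y : vfield) : Prop :=
  forall i, smooth Omega (fun x => Y x 0 i).

Definition riemannian_metric (Omega : set (R * R * R))
    (g : R * R * R -> 'M[R]_3) : Prop :=
  (forall i j, smooth Omega (fun x => g x i j)) /\
  forall x, Omega x -> (g x)^T = g x /\
    forall v : 'rV[R]_3, v != 0 -> 0 < (v *m g x *m v^T) 0 0.

End Fields.

(* A k-covector w is given by w_I = w(e_{I_1}, ..., e_{I_k}), for all (not
   only increasing) multi-indices I; a k-form takes values in the alternating
   arrays. *)
Definition covector (R : realType) (k : nat) : Type := k.-tuple 'I_3 -> R.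
HB.instance Definition _ (R : realType) (k : nat) :=
  GRing.Lmodule.copy (covector R k) (k.-tuple 'I_3 -> R^o).

Definition kform (R : realType) (k : nat) : Type := R * R * R -> covector R k.
HB.instance Definition _ (R : realType) (k : nat) :=
  GRing.Lmodule.copy (kform R k) (R * R * R -> covector R k).

Section Forms.
Variables (R : realType) (Omega : set (R * R * R)) (g : R * R * R -> 'M[R]_3).

Definition alternating_cov k (a : covector R k) : Prop :=
  forall (s : 'S_k) (I : k.-tuple 'I_3),
    a [tuple tnth I (s m) | m < k] = (-1) ^+ s * a I.

Definition smooth_form k : set (kform R k) :=
  [set w | (forall I, smooth Omega (fun x => w x I)) /\
           forall x, Omega x -> alternating_cov (w x)].

Definition csmooth_form k : set (kform R k) :=
  [set w | smooth_form w /\ csupport_in Omega w].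

Definition ext_d k (w : kform R k) : kform R k.+1 := fun x I =>
  \sum_(m < k.+1) (-1) ^+ m *
    partial (tnth I m) (fun y => w y [tuple tnth I (lift m l) | l < k]) x.

(* (L_X w)_I = X^j d_j w_I + \sum_m (d_{I_m} X^j) w_{I with I_m replaced by j} *)
Definition lie_der k (X : vfield) (w : kform R k) : kform R k := fun x I =>
  \sum_(j < 3) X x 0 j * partial j (fun y => w y I) x +
  \sum_(m < k) \sum_(j < 3) partial (tnth I m) (fun y => X y 0 j) x *
    w x [tuple if l == m then j else tnth I l | l < k].

Definition gnorm (x : R * R * R) (v : 'rV[R]_3) : R :=
  Num.sqrt ((v *m g x *m v^T) 0 0).

Definition supnorm (Y : vfield) : \bar R :=
  ereal_sup [set (gnorm x (Y x))%:E | x in Omega].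

(* Christoffel symbol Gamma^i_{jl} of the Levi-Civita connection. *)
Definition christoffel (i j l : 'I_3) (x : R * R * R) : R :=
  2^-1 * \sum_(m < 3) invmx (g x) i m *
    (partial j (fun y => g y m l) x + partial l (fun y => g y m j) x
     - partial m (fun y => g y j l) x).

Definition cov_der (Y Z : vfield) : vfield := fun x =>
  \row_i (\sum_(j < 3) Y x 0 j * partial j (fun y => Z y 0 i) x +
          \sum_(j < 3) \sum_(l < 3) christoffel i j l x * Y x 0 j * Z x 0 l).

Definition vol_density (x : R * R * R) : R := Num.sqrt (\det (g x)).

Definition sharp k (x : R * R * R) (a : covector R k) : covector R k :=
  fun I => \sum_(J : k.-tuple 'I_3)
    (\prod_(m < k) invmx (g x) (tnth I m) (tnth J m)) * a J.

(* The factor 1/k! compensates for summing over all multi-indices. *)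
Definition covector_ip k (x : R * R * R) (a b : covector R k) : R :=
  k`!%:R^-1 * \sum_(I : k.-tuple 'I_3) a I * sharp x b I.

Definition levi_civita (s : seq 'I_3) : R :=
  \det (\matrix_(a < 3, b < 3) (nth ord0 s a == b)%:R : 'M[R]_3).

(* Normalised by a /\ *b = <a, b> vol.  The degree l of the result is kept as
   a separate parameter, since 3 - (3 - k) is not convertible to k; this is the
   Hodge star when k + l = 3. *)
Definition hodge k l (w : kform R k) : kform R l := fun x J =>
  k`!%:R^-1 * vol_density x *
    \sum_(I : k.-tuple 'I_3) levi_civita (I ++ J) * sharp x (w x) I.

(* Elements of L_2^k(Omega) are represented by square-integrable k-forms,
   two of them being identified when they agree a.e. on Omega. *)
Definition L2 k : set (kform R k) :=
  [set u | [/\ forall I, measurable_fun Omega (fun x => u x I),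
     forall x, Omega x -> alternating_cov (u x) &
     (\int[lebesgue3]_(x in Omega)
        (covector_ip x (u x) (u x) * vol_density x)%:E < +oo)%E]].

Definition L2ip k (u v : kform R k) : R :=
  \int[lebesgue3]_(x in Omega) (covector_ip x (u x) (v x) * vol_density x).

Definition L2norm k (u : kform R k) : R := Num.sqrt (L2ip u u).

Definition L2eq k (u v : kform R k) : Prop := ae_eq lebesgue3 Omega u v.

(* An unbounded operator from L_2^j to L_2^k is given by its graph, A u f
   meaning that u is in the domain of A and A u = f; all graphs below are
   compatible with L2eq. *)
Definition L2op j k : Type := kform R j -> kform R k -> Prop.

Definition op_dom j k (A : L2op j k) : set (kform R j) :=
  [set u | exists f, A u f].

(* The operator T with domain (the classes of the elements of) D. *)
Definition op_on j k (T : kform R j -> kform R k) (D : set (kform R j)) :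
    L2op j k :=
  fun u f => [/\ L2 u, L2 f &
    exists2 w, D w & L2eq u w /\ L2eq f (T w)].

Definition adjoint j k (A : L2op j k) : L2op k j :=
  fun v w => [/\ L2 v, L2 w & forall u f, A u f -> L2ip f v = L2ip u w].

Definition graph_norm j k (u : kform R j) (f : kform R k) : R :=
  Num.sqrt (L2norm u ^+ 2 + L2norm f ^+ 2).

Definition op_closure j k (A : L2op j k) : L2op j k :=
  fun u f => [/\ L2 u, L2 f & forall eps : R, 0 < eps ->
    exists u' f', A u' f' /\ graph_norm (u - u') (f - f') < eps].

(* S is a subset of dom A that is dense for the graph norm of A. *)
Definition dense_in_dom j k (A : L2op j k) (S : set (kform R j)) : Prop :=
  S `<=` op_dom A /\
  forall u f, A u f -> forall eps : R, 0 < eps ->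
    exists v h, [/\ S v, A v h & graph_norm (u - v) (f - h) < eps].

Definition d_c k : L2op k k.+1 := op_on (@ext_d k) (@csmooth_form k).

Definition d_ring k : L2op k k.+1 := op_closure (@d_c k).

Definition lie_c k (X : vfield) : L2op k k :=
  op_on (@lie_der k X) (@csmooth_form k).

(* L_X := - * (L_{X,c})^* *, the adjoint being taken in degree 3 - k. *)
Definition lie k (X : vfield) : L2op k k :=
  fun u f => [/\ L2 u, L2 f &
    exists2 w, adjoint (@lie_c (3 - k) X) (@hodge k (3 - k) u) w &
               L2eq f (- @hodge (3 - k) k w)].

(* (1 + eta A)[D], for D a subset of dom A. *)
Definition one_plus_image k (eta : R) (A : L2op k k) (D : set (kform R k)) :
    set (kform R k) :=
  [set v | L2 v /\ exists u f, [/\ D u, A u f & L2eq v (u + eta *: f)]].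

End Forms.

Arguments smooth_form {R} Omega k.
Arguments d_c {R} Omega g k.
Arguments d_ring {R} Omega g k.
Arguments lie_c {R} Omega g k X.
Arguments lie {R} Omega g k X.

(* Main.v *)
Require Import Defs.
From HB Require Import structures.
From mathcomp Require Import all_boot all_order all_algebra all_fingroup.
From mathcomp Require Import all_classical all_reals all_analysis.
From mathcomp Require Import measurable_realfun lebesgue_integral_under.
From mathcomp Require Import ring lra.
Set Implicit Arguments.
Unset Strict Implicit.
Unset Printing Implicit Defensive.
Import Order.TTheory GRing.Theory Num.Theory.
Import numFieldNormedType.Exports.
Local Open Scope classical_set_scope.
Local Open Scope ring_scope.

(** The space of compactly supported smooth forms is a core of the closed
    exterior derivative, so it is enough to see that each such form w already
    lies in the image of 1 + eta L, where L is the Lie derivative along e3.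
    Since e3 is a coordinate field, L differentiates the components along the
    third axis, and u + eta L u = w is solved by the Laplace transform of the
    translations,
      u (x) = \int_0^oo exp (-r) w (x - eta r e3) dr,
    for either sign of eta and also for eta = 0. The form u is smooth
    ([resolvent_smooth]) but not compactly supported: it lives over the compact
    projection K of the support of w, and its components decay like
    exp (- l |t|) at height t for every l with l |eta| <= 1/2
    ([resolvent_decay]).

    Whether u is square integrable therefore depends on the growth of the
    metric along vertical lines, and this is where the bound on nabla e3
    enters. By Koszul's formula the symmetric part of nabla e3 is half of the
    derivative of g along e3 ([nablae3_pairing]); cutting off constant fields
    with bump functions, the bound becomes |d_3 g (v, v)| <= c g (v, v)
    ([d3metric_bound]), and Gronwall's inequality shows that g, its inverse and
    its volume density vary at most exponentially over K, at a rate fixed by c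
    ([metric_growth]). When eta is small, l can be chosen larger than that
    rate, and u, L u and their Hodge stars are square integrable
    ([decaying_hodge], [decaying_L2]).

    It remains that u belongs to the domain of L, which is defined by duality
    with the Lie derivative on compactly supported forms phi of complementary
    degree. The pairing of phi with a star is the integral of a wedge product,
    in which the metric no longer appears ([covector_ip_hodge]); as phi has
    compact support, one may integrate by parts along the third axis
    ([wedge_byparts], [integral_vderiv0]). Two facts of linear algebra, the
    transformation rule of the Levi-Civita symbol and ** = 1 ([hodge_hodge]),
    do the rest. *)

(** * The Levi-Civita symbol *)

Lemma big_tuple0 (V : nmodType) (T : finType) (F : seq T -> V) :
  \sum_(t : 0.-tuple T) F t = F [::].
Proof.
rewrite (eq_bigr (fun=> F [::])) => [|t _]; last by rewrite tuple0.
by rewrite sumr_const card_tuple expn0.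
Qed.

Lemma big_tupleS (V : nmodType) (T : finType) n (F : seq T -> V) :
  \sum_(t : n.+1.-tuple T) F t = \sum_(a : T) \sum_(t : n.-tuple T) F (a :: t).
Proof.
rewrite pair_big /=.
rewrite (reindex (fun p : T * n.-tuple T => [tuple of p.1 :: p.2])) //=.
exists (fun t : n.+1.-tuple T => (thead t, [tuple of behead t])) => [[a t] _|t _] /=.
  by congr (_, _); apply/val_inj.
by rewrite -tuple_eta.
Qed.

Lemma big_tuple1 (V : nmodType) (T : finType) (F : seq T -> V) :
  \sum_(t : 1.-tuple T) F t = \sum_(a : T) F [:: a].
Proof.
by rewrite big_tupleS; apply: eq_bigr => a _; exact: (big_tuple0 (fun t => F (a :: t))).
Qed.

Lemma big_tuple2 (V : nmodType) (T : finType) (F : seq T -> V) :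
  \sum_(t : 2.-tuple T) F t = \sum_(a : T) \sum_(b : T) F [:: a; b].
Proof.
by rewrite big_tupleS; apply: eq_bigr => a _; exact: (big_tuple1 (fun t => F (a :: t))).
Qed.

Lemma big_tuple3 (V : nmodType) (T : finType) (F : seq T -> V) :
  \sum_(t : 3.-tuple T) F t = \sum_(a : T) \sum_(b : T) \sum_(c : T) F [:: a; b; c].
Proof.
by rewrite big_tupleS; apply: eq_bigr => a _; exact: (big_tuple2 (fun t => F (a :: t))).
Qed.

Lemma big_tuple_cat (V : nmodType) (T : finType) k l (F : seq T -> V) :
  \sum_(t : (k + l).-tuple T) F t =
  \sum_(I : k.-tuple T) \sum_(J : l.-tuple T) F (I ++ J).
Proof.
elim: k F => [|k IH] F.
  by rewrite (big_tuple0 (fun I => \sum_(J : l.-tuple T) F (I ++ J))).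
rewrite (big_tupleS _ F) (big_tupleS _ (fun I => \sum_(J : l.-tuple T) F (I ++ J))).
by apply: eq_bigr => a _; rewrite (IH (fun t => F (a :: t))).
Qed.

Section Levi_civita.
Variable R : realType.
Implicit Types (A : 'M[R]_3).

(** The entry of a tensor power of A, on sequences so that it splits along
    concatenation. *)
Definition entryprod A (s t : seq 'I_3) : R := \prod_(p <- zip s t) A p.1 p.2.

Lemma entryprod_tnth k A (I J : k.-tuple 'I_3) :
  \prod_(m < k) A (tnth I m) (tnth J m) = entryprod A I J.
Proof.
rewrite /entryprod (big_nth (ord0, ord0)) big_mkord size_zip !size_tuple minnn.
apply: eq_bigr => i _; rewrite nth_zip ?size_tuple//=.
by rewrite -!tnth_nth.
Qed.

Lemma entryprod_cat A (s t s' t' : seq 'I_3) : size s = size t ->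
  entryprod A (s ++ s') (t ++ t') = entryprod A s t * entryprod A s' t'.
Proof. by move=> st; rewrite /entryprod zip_cat// big_cat. Qed.

Lemma entryprodC A (s t : seq 'I_3) : A^T = A -> entryprod A s t = entryprod A t s.
Proof.
move=> As; elim: s t => [|a s IH] [|b t]; rewrite /entryprod ?big_nil//=.
  by rewrite !big_cons /= -{1}As mxE; congr (_ * _); exact: IH.
Qed.

Lemma levi_civitaE (s : seq 'I_3) :
  levi_civita R s = \sum_(p : 'S_3) (-1) ^+ p *
    \prod_(a < 3) (nth ord0 s a == p a)%:R.
Proof. by apply: eq_bigr => p _; congr (_ * _); apply: eq_bigr => a _; rewrite mxE. Qed.

(** Both sides are the determinant of the matrix formed by the rows t of A: on
    the left it is expanded by multilinearity of the rows, on the right it is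
    the determinant of a product. *)
Lemma sum_entryprod_levi_civita A (t : 3.-tuple 'I_3) :
  \sum_(s : 3.-tuple 'I_3) entryprod A t s * levi_civita R s =
  \det A * levi_civita R t.
Proof.
have -> : \det A * levi_civita R t =
    \det ((\matrix_(a < 3, b < 3) (tnth t a == b)%:R) *m A).
  rewrite det_mulmx mulrC; congr (_ * _); rewrite /levi_civita.
  by congr (\det _); apply/matrixP => a b; rewrite !mxE (tnth_nth ord0).
transitivity (\sum_(p : 'S_3) (-1) ^+ p * \prod_(a < 3) A (tnth t a) (p a)); last first.
  apply: eq_bigr => p _; congr (_ * _); apply: eq_bigr => a _.
  rewrite mxE (bigD1 (tnth t a))//= mxE eqxx mul1r big1 ?addr0// => b.
  by rewrite mxE eq_sym => /negbTE ->; rewrite mul0r.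
under eq_bigr do rewrite levi_civitaE big_distrr /=.
rewrite exchange_big /=; apply: eq_bigr => p _.
have [s0 s0E] : exists s0 : 3.-tuple 'I_3, forall a, tnth s0 a = p a.
  by exists [tuple p a | a < 3] => a; rewrite tnth_mktuple.
rewrite (bigD1 s0)//= [X in _ + X]big1 ?addr0 => [|s ss0].
  rewrite mulrCA -entryprod_tnth [X in _ * (_ * X)]big1; last first.
    by move=> a _; rewrite -tnth_nth s0E eqxx.
  by rewrite mulr1; congr (_ * _); apply: eq_bigr => a _; rewrite s0E.
rewrite mulrCA.
have [a sa] : exists a, tnth s a != p a.
  apply/existsP; rewrite -negb_forall; apply: contra ss0 => /forallP h.
  by apply/eqP/eq_from_tnth => a; rewrite s0E; apply/eqP.
by rewrite (bigD1 a)//= -tnth_nth (negbTE sa) !(mul0r, mulr0).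
Qed.

Lemma sum_entryprod_levi_civita_cat k l A (M : k.-tuple 'I_3) (I : l.-tuple 'I_3) :
  (k + l)%N = 3 ->
  \sum_(K : k.-tuple 'I_3) \sum_(J : l.-tuple 'I_3)
    entryprod A M K * entryprod A I J * levi_civita R (K ++ J) =
  \det A * levi_civita R (M ++ I).
Proof.
move=> kl3; have szMI : size (M ++ I) == 3 by rewrite size_cat !size_tuple kl3.
have /= := @sum_entryprod_levi_civita A (Tuple szMI).
have -> : \sum_(s : 3.-tuple 'I_3) entryprod A (M ++ I) s * levi_civita R s =
   \sum_(s : (k + l).-tuple 'I_3) entryprod A (M ++ I) s * levi_civita R s.
  by rewrite kl3.
rewrite (big_tuple_cat k l (fun s => entryprod A (M ++ I) s * levi_civita R s)).
move=> <-; apply: eq_bigr => K _; apply: eq_bigr => J _.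
by rewrite entryprod_cat// !size_tuple.
Qed.

(** The permutation of J extends to the whole word by fixing the prefix, one
    [lift_perm] for each letter, and then permutes the rows of the
    determinant. *)
Lemma levi_civita_perm l (s : seq 'I_3) (J : l.-tuple 'I_3) (p : 'S_l) :
  (size s + l)%N = 3 ->
  levi_civita R (s ++ [tuple tnth J (p m) | m < l]) =
  (-1) ^+ p * levi_civita R (s ++ J).
Proof.
move=> sl.
have /(_ _ (esym sl)) [q [qp qE]] : forall n, n = (size s + l)%N -> exists q : 'S_n,
   odd_perm q = odd_perm p /\ forall a : 'I_n,
   nth ord0 (s ++ [tuple tnth J (p m) | m < l]) a = nth ord0 (s ++ J) (q a).
  move=> {sl} n; elim: s n => [|b s IH] n /=.
    rewrite add0n => ->; exists p; split=> // a.
    by rewrite -(tnth_nth ord0 [tuple tnth J (p m) | m < l]) tnth_mktuple -tnth_nth.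
  case: n => // n [nE]; have [q [qp qE]] := IH _ nE.
  exists (lift_perm ord0 ord0 q); rewrite odd_lift_perm qp; split => // a.
  case: (unliftP ord0 a) => [c ->|->]; last by rewrite lift_perm_id.
  by rewrite lift_perm_lift !lift0 /= qE.
rewrite /levi_civita -qp -det_perm -det_mulmx -row_permE; congr (\det _).
by apply/matrixP => a b; rewrite !mxE qE.
Qed.

(** On indices below 3 the Vandermonde product, halved, takes the values 0, 1
    and -1 of the Levi-Civita symbol; this turns its contractions into finite
    computations. *)
Definition vandermonde3 (a b c : nat) : R :=
  2^-1 * ((b%:R - a%:R) * (c%:R - a%:R) * (c%:R - b%:R)).

Lemma det3 (M : 'M[R]_3) (i0 := ord0 : 'I_3) (i1 := lift ord0 ord0 : 'I_3)
    (i2 := ord_max : 'I_3) : \det M =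
  M i0 i0 * (M i1 i1 * M i2 i2 - M i1 i2 * M i2 i1)
  - M i0 i1 * (M i1 i0 * M i2 i2 - M i1 i2 * M i2 i0)
  + M i0 i2 * (M i1 i0 * M i2 i1 - M i1 i1 * M i2 i0).
Proof.
rewrite (expand_det_row _ ord0) !big_ord_recl big_ord0 /cofactor /=.
rewrite !(expand_det_row _ ord0) !big_ord_recl !big_ord0 /cofactor /= !det_mx11 !mxE /=.
have [f L] : exists f : nat -> nat -> R, forall i j : 'I_3, M i j = f i j.
  by exists (fun x y => M (inord x) (inord y)) => i j; rewrite !inord_val.
rewrite !L /= /bump /=.
ring.
Qed.

Lemma levi_civita3 (a b c : 'I_3) : levi_civita R [:: a; b; c] = vandermonde3 a b c.
Proof.
rewrite /levi_civita det3 !mxE /vandermonde3.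
case: a => [[|[|[|//]]] ?]; case: b => [[|[|[|//]]] ?]; case: c => [[|[|[|//]]] ?];
  rewrite -!(inj_eq val_inj) /=; by field.
Qed.

(** The determinant on the right is the generalised Kronecker delta. For k = 3
    nothing is summed and the identity is det P det Q^T = det (P Q^T); in the
    lower degrees it is checked index by index. *)
Lemma levi_civita_contract k l (J M : k.-tuple 'I_3) : (k + l)%N = 3 ->
  \sum_(I : l.-tuple 'I_3) levi_civita R (I ++ J) * levi_civita R (M ++ I) =
  l`!%:R * \det (\matrix_(a < k, b < k) (tnth J a == tnth M b)%:R : 'M[R]_k).
Proof.
case: k J M => [|[|[|[|//]]]] J M; rewrite ?add0n ?add1n ?add2n.
- move=> ->; rewrite [J]tuple0 [M]tuple0 det_mx00 /=.
  rewrite (big_tuple3 (fun I => levi_civita R (I ++ [::]) * levi_civita R I)).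
  under eq_bigr do under eq_bigr do under eq_bigr do rewrite levi_civita3.
  rewrite !big_ord_recl !big_ord0 /= /bump /= /vandermonde3 (_ : 3`! = 6%N)//; by field.
- move=> [->]; rewrite det_mx11 mxE.
  case/tupleP: J => j J; case/tupleP: M => m M; rewrite [J]tuple0 [M]tuple0 !tnth0 /=.
  rewrite (big_tuple2 (fun I => levi_civita R (I ++ [:: j]) * levi_civita R (m :: I))).
  under eq_bigr do under eq_bigr do rewrite !levi_civita3.
  rewrite (_ : 2`! = 2%N)//.
  rewrite !big_ord_recl !big_ord0 /= /bump /= /vandermonde3 -!(inj_eq val_inj) /=.
  case: j => [[|[|[|//]]] ?]; case: m => [[|[|[|//]]] ?] /=; by field.
- move=> [->].
  have -> : forall A : 'M[R]_2,
      \det A = A ord0 ord0 * A ord_max ord_max - A ord0 ord_max * A ord_max ord0.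
    move=> A; rewrite (expand_det_row _ ord0) !big_ord_recl !big_ord0 /cofactor /=.
    rewrite !det_mx11 !mxE /=.
    have [f L] : exists f : nat -> nat -> R, forall i j : 'I_2, A i j = f i j.
      by exists (fun x y => A (inord x) (inord y)) => i j; rewrite !inord_val.
    rewrite !L /= /bump /=; ring.
  case/tupleP: J => j1 J; case/tupleP: M => m1 M; case/tupleP: J => j2 J; case/tupleP: M => m2 M.
  rewrite [J]tuple0 [M]tuple0 !mxE !(tnth_nth ord0) /=.
  rewrite (big_tuple1 (fun I => levi_civita R (I ++ [:: j1; j2]) * levi_civita R (m1 :: m2 :: I))).
  under eq_bigr do rewrite !levi_civita3.
  rewrite (_ : 1`! = 1%N)//.
  rewrite !big_ord_recl !big_ord0 /= /bump /= /vandermonde3 -!(inj_eq val_inj) /=.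
  case: j1 => [[|[|[|//]]] ?]; case: m1 => [[|[|[|//]]] ?] /=;
  case: j2 => [[|[|[|//]]] ?]; case: m2 => [[|[|[|//]]] ?] /=; by field.
- rewrite -[X in _ = X -> _]addn0 => /addnI ->.
  rewrite (big_tuple0 (fun I => levi_civita R (I ++ J) * levi_civita R (M ++ I))).
  rewrite cats0 /= mul1r /levi_civita -[X in _ * X]det_tr -det_mulmx; congr (\det _).
  apply/matrixP => a b; rewrite !mxE (bigD1 (tnth J a))//= !mxE -!tnth_nth eqxx mul1r.
  rewrite big1 ?addr0 ?[tnth M b == _]eq_sym// => i; rewrite !mxE -!tnth_nth eq_sym => /negbTE ->.
  by rewrite mul0r.
Qed.

(** The generalised Kronecker delta antisymmetrises: in its Leibniz expansion
    each of the k! permutations contributes u J. *)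
Lemma alternating_contract k (u : covector R k) (J : k.-tuple 'I_3) : alternating_cov u ->
  \sum_(M : k.-tuple 'I_3)
    \det (\matrix_(a < k, b < k) (tnth J a == tnth M b)%:R : 'M[R]_k) * u M =
  k`!%:R * u J.
Proof.
move=> ualt; under eq_bigr do rewrite big_distrl /=.
rewrite exchange_big /=.
rewrite (eq_bigr (fun=> u J)) => [|p _].
  by rewrite sumr_const card_Sn mulr_natl.
pose K := [tuple tnth J ((p^-1)%g m) | m < k].
rewrite (bigD1 K)//= [X in _ + X]big1 ?addr0 => [|M MK].
  rewrite big1 => [|a _]; last by rewrite mxE tnth_mktuple permK eqxx.
  by rewrite mulr1 /K ualt odd_permV mulrA -signr_addb addbb mul1r.
have [a Ma] : exists a, tnth J a != tnth M (p a).
  apply/existsP; rewrite -negb_forall; apply: contra MK => /forallP h.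
  apply/eqP/eq_from_tnth => a; rewrite tnth_mktuple.
  by move/eqP: (h ((p^-1)%g a)); rewrite permKV.
by rewrite (bigD1 a)//= mxE (negbTE Ma) !(mul0r, mulr0).
Qed.

End Levi_civita.

(** * The Hodge star of a positive definite metric *)

Section Positive_definite.
Variable R : realType.
Implicit Types (A : 'M[R]_3).

Definition posdef A := forall v : 'rV[R]_3, v != 0 -> 0 < (v *m A *m v^T) 0 0.

Lemma posdef_det_neq0 A : posdef A -> \det A != 0.
Proof.
move=> Ap; apply/negP => /det0P[v v0 vA].
by have := Ap v v0; rewrite vA mul0mx mxE ltxx.
Qed.

Lemma dot_gt0 (v : 'rV[R]_3) : v != 0 -> 0 < (v *m v^T) 0 0.
Proof.
move=> v0; rewrite lt0r mxE; apply/andP; split; last first.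
  by apply: sumr_ge0 => i _; rewrite mxE -expr2 sqr_ge0.
apply: contra v0 => /eqP /psumr_eq0P h; apply/eqP/rowP => i; rewrite mxE.
have /h/(_ i isT) : forall i : 'I_3, true -> 0 <= v 0 i * v^T i 0.
  by move=> j _; rewrite mxE -expr2 sqr_ge0.
by rewrite mxE -expr2 => /eqP; rewrite sqrf_eq0 => /eqP.
Qed.

(** Every form on the segment from the identity to A is positive definite, so
    the determinant, a polynomial in the parameter with value 1 at 0, has no
    root there and keeps its sign. *)
Lemma posdef_det_gt0 A : posdef A -> 0 < \det A.
Proof.
move=> Ap.
pose P : 'M[{poly R}]_3 := (1 - 'X)%:M + 'X *: map_mx polyC A.
have PE t : (\det P).[t] = \det ((1 - t)%:M + t *: A).
  rewrite -horner_evalE -det_map_mx; congr (\det _); apply/matrixP => i j.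
  by rewrite !mxE rmorphD rmorphMn rmorphM rmorphB rmorph1 /= !horner_evalE hornerX hornerC.
have P0 t : 0 <= t <= 1 -> (\det P).[t] != 0.
  move=> /andP[t0 t1]; rewrite PE; apply: posdef_det_neq0 => v v0.
  rewrite mulmxDr mulmxDl mul_mx_scalar -scalemxAr -!scalemxAl.
  rewrite [ltRHS]mxE [X in X + _]mxE [X in _ + X]mxE.
  have [->|tn0] := eqVneq t 0.
    by rewrite subr0 mul1r mul0r addr0 dot_gt0.
  rewrite ltr_wpDl//; first by rewrite mulr_ge0 ?subr_ge0// ltW// dot_gt0.
  by rewrite mulr_gt0 ?Ap// lt0r tn0.
have -> : \det A = (\det P).[1] by rewrite PE subrr scale1r raddf0 add0r.
have P00 : (\det P).[0] = 1 by rewrite PE subr0 scale0r addr0 det1.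
rewrite ltNge; apply/negP => P1.
have [||c + /eqP] := @IVT R (horner (\det P)) 0 1 0 ler01.
- by apply: continuous_subspaceT => x; exact: continuous_horner.
- by rewrite P00 ge_min le_max P1 orbT ler01.
- by rewrite in_itv /= => c01; rewrite (negbTE (P0 _ c01)).
Qed.

End Positive_definite.

Section Hodge.
Variables (R : realType) (g : R * R * R -> 'M[R]_3) (x : R * R * R).
Hypotheses (gsym : (g x)^T = g x) (gdet : 0 < \det (g x)).

Lemma vol_density_gt0 : 0 < vol_density g x.
Proof. by rewrite sqrtr_gt0. Qed.

Lemma sharpE k (a : covector R k) I :
  sharp g x a I = \sum_(J : k.-tuple 'I_3) entryprod (invmx (g x)) I J * a J.
Proof. by apply: eq_bigr => J _; rewrite entryprod_tnth. Qed.

Lemma invmx_sym : (invmx (g x))^T = invmx (g x).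
Proof. by rewrite trmx_inv gsym. Qed.

(** Raising the remaining indices of a star lets the inverse metric act on all
    three indices of the Levi-Civita symbol, which only costs its determinant. *)
Lemma sharp_hodge k l (u : kform R k) (I : l.-tuple 'I_3) : (k + l)%N = 3 ->
  sharp g x (hodge g u x) I = k`!%:R^-1 * (vol_density g x)^-1 *
    \sum_(M : k.-tuple 'I_3) levi_civita R (M ++ I) * u x M.
Proof.
move=> kl; rewrite sharpE /hodge.
have -> : (vol_density g x)^-1 = vol_density g x * \det (invmx (g x)).
  apply: (mulfI (lt0r_neq0 vol_density_gt0)).
  rewrite divff ?(lt0r_neq0 vol_density_gt0)// mulrA -expr2 sqr_sqrtr ?ltW//.
  by rewrite det_inv divff// gt_eqF.
rewrite mulrA -[in RHS]mulrA big_distrr /=.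
under [in RHS]eq_bigr => M _ do rewrite mulrA -sum_entryprod_levi_civita_cat//.
under eq_bigr => J _ do rewrite mulrCA.
rewrite -big_distrr /=; congr (_ * _).
under eq_bigr => J _.
  under eq_bigr => K _ do rewrite sharpE big_distrr /=.
  rewrite exchange_big big_distrr /=; over.
rewrite exchange_big /=; apply: eq_bigr => M _.
rewrite exchange_big big_distrl /=.
under [in RHS]eq_bigr do rewrite big_distrl /=.
apply: eq_bigr => J _; rewrite big_distrr; apply: eq_bigr => K _ /=.
rewrite (entryprodC K M invmx_sym); ring.
Qed.

(** This is a /\ u up to order: the metric has cancelled, which is why the
    integration by parts behind the adjoint does not see it. *)
Lemma covector_ip_hodge k l (a : covector R l) (u : kform R k) : (k + l)%N = 3 ->
  covector_ip g x a (hodge g u x) * vol_density g x = l`!%:R^-1 * k`!%:R^-1 *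
  \sum_(I : l.-tuple 'I_3) \sum_(M : k.-tuple 'I_3)
     levi_civita R (M ++ I) * (a I * u x M).
Proof.
move=> kl; rewrite /covector_ip.
have v0 := lt0r_neq0 vol_density_gt0.
under eq_bigr do rewrite sharp_hodge//.
rewrite -!mulrA; congr (_ * _); rewrite big_distrl /= big_distrr /=.
apply: eq_bigr => I _; rewrite -[LHS]mulrA (mulrC _ (vol_density _ _)).
have -> : \sum_(M : k.-tuple 'I_3) levi_civita R (M ++ I) * (a I * u x M) =
    a I * \sum_(M : k.-tuple 'I_3) levi_civita R (M ++ I) * u x M.
  by rewrite big_distrr; apply: eq_bigr => M _ /=; rewrite mulrCA.
have kf : k`!%:R != 0 :> R by rewrite pnatr_eq0 -lt0n fact_gt0.
by field; rewrite v0 kf.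
Qed.

(** In dimension 3 the sign (-1)^(k l) is always 1. *)
Lemma hodge_hodge k l (u : kform R k) (J : k.-tuple 'I_3) : (k + l)%N = 3 ->
  alternating_cov (u x) ->
  hodge g (hodge g u : kform R l) x J = u x J.
Proof.
move=> kl ualt; have v0 := lt0r_neq0 vol_density_gt0.
rewrite /hodge -/(hodge g u : kform R l).
under eq_bigr do rewrite sharp_hodge//.
under eq_bigr do rewrite mulrCA big_distrr /=.
rewrite -big_distrr exchange_big /=.
have -> : \sum_(M : k.-tuple 'I_3) \sum_(I : l.-tuple 'I_3)
    levi_civita R (I ++ J) * (levi_civita R (M ++ I) * u x M) = l`!%:R * (k`!%:R * u x J).
  rewrite -alternating_contract// big_distrr /=; apply: eq_bigr => M _.
  rewrite mulrA -levi_civita_contract// big_distrl /=.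
  by apply: eq_bigr => I _; rewrite mulrA.
have lf : l`!%:R != 0 :> R by rewrite pnatr_eq0 -lt0n fact_gt0.
have kf : k`!%:R != 0 :> R by rewrite pnatr_eq0 -lt0n fact_gt0.
by field; rewrite lf v0 kf.
Qed.

Lemma hodge_alternating k l (u : kform R k) : (k + l)%N = 3 ->
  alternating_cov (hodge g u x : covector R l).
Proof.
move=> kl s J; rewrite /hodge mulrCA; congr (_ * _); rewrite big_distrr /=.
apply: eq_bigr => I _; rewrite mulrA; congr (_ * _).
by rewrite levi_civita_perm// size_tuple.
Qed.

End Hodge.

(** * Smooth functions on open sets of space *)

Section Smooth.
Variable R : realType.
Local Notation R3 := (R * R * R)%type.
Implicit Types (U : set R3) (f g : R3 -> R).

(** The definition of [smooth] runs over words of derivatives; stability under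
    products, and under changes outside the open set, needs an induction on
    the order instead. *)
Fixpoint Cn n U f : Prop :=
  (forall x, U x -> {for x, continuous f}) /\
  if n is m.+1 then forall i, (forall x, U x -> derivable f x (coord_vec i)) /\ Cn m U (partial i f)
  else True.

Lemma Cn_cont n U f x : Cn n U f -> U x -> {for x, continuous f}.
Proof. by case: n => [|n] [cf _]; exact: cf. Qed.

Lemma smooth_partial U f i : smooth U f -> smooth U (partial i f).
Proof. by move=> sf s x Ux; have := sf (rcons s i) x Ux; rewrite foldr_rcons. Qed.

Lemma smooth_cont U f x : smooth U f -> U x -> {for x, continuous f}.
Proof. by move=> sf Ux; have [] := sf [::] x Ux. Qed.

Lemma smooth_derivable U f x i : smooth U f -> U x -> derivable f x (coord_vec i).
Proof. by move=> sf Ux; have [] := sf [::] x Ux. Qed.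

Lemma smooth_Cn U f : smooth U f <-> forall n, Cn n U f.
Proof.
split=> [sf n|].
  elim: n f sf => [|n IH] f sf.
    by split=> // x; exact: smooth_cont.
  split=> [x|i]; first exact: smooth_cont.
  by split=> [x|]; [exact: smooth_derivable|exact/IH/smooth_partial].
move=> Cf s x Ux.
have : Cn (size s).+1 U f by [].
move=> {Cf}; elim/last_ind: s f => [|s i IH] f.
  by move=> [cf df]; split=> [|i]; [exact: cf|have [+ _] := df i; exact].
by rewrite size_rcons foldr_rcons => -[_ df]; apply: IH; have [] := df i.
Qed.

Lemma Cn_ext n U f g : open U -> (forall x, U x -> f x = g x) -> Cn n U f -> Cn n U g.
Proof.
move=> oU; elim: n f g => [|n IH] f g fg [cf df].
- split=> // x Ux; rewrite /prop_for /continuous_at -fg//.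
  apply: cvg_trans (cf x Ux); apply: near_eq_cvg.
  by have := open_nbhs_nbhs (conj oU Ux); apply: filterS => y Uy /=; rewrite fg.
have nfg x : U x -> \forall y \near x, f y = g y.
  by move=> Ux; have := open_nbhs_nbhs (conj oU Ux); apply: filterS => y; exact: fg.
split=> [x Ux|i].
  rewrite /prop_for /continuous_at -fg//.
  apply: cvg_trans (cf x Ux); apply: near_eq_cvg.
  by have := nfg x Ux; apply: filterS => y ->.
have [dfi Cfi] := df i; split=> [x Ux|].
  by apply: near_eq_derivable (dfi x Ux); exact: nfg.
by apply: IH Cfi => x Ux; apply: near_eq_derive; exact: nfg.
Qed.

Lemma Cn_mono n U f : Cn n.+1 U f -> Cn n U f.
Proof.
elim: n f => [|n IH] f [cf df]; split=> // i.
by have [dfi Cfi] := df i; split=> //; exact: IH.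
Qed.

Lemma CnD n U f g : open U -> Cn n U f -> Cn n U g -> Cn n U (fun x => f x + g x).
Proof.
move=> oU; elim: n f g => [|n IH] f g [cf df] [cg dg].
  by split=> // x Ux; apply: cvgD; [exact: cf|exact: cg].
split=> [x Ux|i]; first by apply: cvgD; [exact: cf|exact: cg].
have [dfi Cfi] := df i; have [dgi Cgi] := dg i; split=> [x Ux|].
  by apply: derivableD; [exact: dfi|exact: dgi].
apply: Cn_ext (IH _ _ Cfi Cgi) => // x Ux.
by rewrite /partial [RHS]deriveD//; [exact: dfi|exact: dgi].
Qed.

Lemma CnM n U f g : open U -> Cn n U f -> Cn n U g -> Cn n U (fun x => f x * g x).
Proof.
move=> oU; elim: n f g => [|n IH] f g Cf Cg; have [cf df] := Cf; have [cg dg] := Cg.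
  by split=> // x Ux; apply: cvgM; [exact: cf|exact: cg].
split=> [x Ux|i]; first by apply: cvgM; [exact: cf|exact: cg].
have [dfi Cfi] := df i; have [dgi Cgi] := dg i; split=> [x Ux|].
  by apply: derivableM; [exact: dfi|exact: dgi].
apply: Cn_ext (CnD oU (IH _ _ (Cn_mono Cf) Cgi) (IH _ _ Cfi (Cn_mono Cg))) => // x Ux.
rewrite /partial [RHS]deriveM//; [|exact: dfi|exact: dgi].
by rewrite /GRing.scale /= [X in _ = _ + X]mulrC.
Qed.

Lemma Cn_cst n U (c : R) : open U -> Cn n U (fun=> c).
Proof.
move=> oU; elim: n c => [|n IH] c; first by split=> // x _; exact: cvg_cst.
split=> [x _|i]; first exact: cvg_cst.
split=> [x _|]; first exact: derivable_cst.
by apply: Cn_ext (IH 0) => // x Ux; rewrite /partial derive_cst.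
Qed.

Lemma smoothM U f g : open U -> smooth U f -> smooth U g -> smooth U (fun x => f x * g x).
Proof. by move=> oU /smooth_Cn sf /smooth_Cn sg; apply/smooth_Cn => n; exact: CnM. Qed.

Lemma smooth_cst U (c : R) : open U -> smooth U (fun=> c).
Proof. by move=> oU; apply/smooth_Cn => n; exact: Cn_cst. Qed.

Lemma smooth_ext U f g : open U -> (forall x, U x -> f x = g x) -> smooth U f -> smooth U g.
Proof. by move=> oU fg /smooth_Cn sf; apply/smooth_Cn => n; exact: Cn_ext (sf n). Qed.

Lemma smooth_sub U V f : V `<=` U -> smooth U f -> smooth V f.
Proof. by move=> VU sf s x /VU; exact: sf. Qed.

Lemma is_derive_line f x v s : derivable f (x + s *: v) v ->
  is_derive s 1 (fun s => f (x + s *: v)) ('D_v f (x + s *: v)).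
Proof.
move=> df.
have E : (fun h : R => h^-1 *: (f (x + (h *: 1 + s) *: v) - f (x + s *: v))) =
    (fun h => h^-1 *: (f (h *: v + (x + s *: v)) - f (x + s *: v))).
  by apply/funext => h; congr (_ *: (f _ - _)); rewrite [h *: 1]mulr1 scalerDl addrCA.
apply: DeriveDef; first by rewrite /derivable /= E.
by rewrite /derive /= E.
Qed.

Lemma is_derive_sumf (V : normedModType R) (I : finType) (f : I -> V -> R)
    (df : I -> R) (x v : V) : (forall i, is_derive x v (f i) (df i)) ->
  is_derive x v (fun y => \sum_i f i y) (\sum_i df i).
Proof.
move=> fd; have -> : (fun y => \sum_i f i y) = \sum_i f i.
  by apply/funext => y; rewrite fct_sumE.
by elim/big_ind2 : _ => // [|] *; [exact: is_derive_cst|exact: is_deriveD].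
Qed.

End Smooth.

(** * Bump functions *)

Lemma fst_continuous (U V : topologicalType) : continuous (@fst U V).
Proof. by move=> p; exact: (@cvg_fst U V (nbhs p.1) (nbhs p.2)). Qed.

Lemma snd_continuous (U V : topologicalType) : continuous (@snd U V).
Proof. by move=> p; exact: (@cvg_snd U V (nbhs p.1) (nbhs p.2)). Qed.

Lemma compact_fst (U V : topologicalType) (K : set (U * V)) :
  compact K -> compact (fst @` K).
Proof.
move=> cK; apply: continuous_compact => //.
by apply: continuous_subspaceT => x; exact: fst_continuous.
Qed.

Section Bump.
Variable R : realType.
Local Notation R3 := (R * R * R)%type.

(** For n = 0 the classical function exp (-1/t); the factors 1/t make the
    family stable under differentiation. *)
Definition flat n (t : R) : R := if 0 < t then t^-1 ^+ n * expR (- t^-1) else 0.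

Lemma flat_ge0 n t : 0 <= flat n t.
Proof.
rewrite /flat; case: ifP => // t0.
by rewrite mulr_ge0 ?expR_ge0// exprn_ge0// invr_ge0 ltW.
Qed.

(** This is y <= exp y at y = 1 / ((n + 1) t), raised to the power n + 1. *)
Lemma flat_le_lin n t : flat n t <= n.+1%:R ^+ n.+1 * `|t|.
Proof.
rewrite /flat; case: ifPn => t0; last by rewrite mulr_ge0// exprn_ge0.
have n0 : 0 < n.+1%:R :> R by rewrite ltr0n.
rewrite gtr0_norm// expRN -(ler_pM2r (expR_gt0 t^-1)) divfK ?gt_eqF ?expR_gt0//.
rewrite -(ler_pM2r (_ : 0 < t^-1)) ?invr_gt0// -exprSr.
rewrite -mulrA (mulrC (expR _)) mulrA mulfK ?gt_eqF//.
have -> : expR t^-1 = expR (t^-1 / n.+1%:R) ^+ n.+1.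
  by rewrite -expRM_natl mulrC divfK ?gt_eqF.
rewrite -exprMn; apply: lerXn2r; rewrite ?nnegrE ?invr_ge0 ?(ltW t0)//.
rewrite mulrC -ler_pdivrMr// (le_trans _ (expR_ge1Dx _))// lerDr ler01//.
Qed.

Lemma flatS n t : t != 0 -> flat n t / t = flat n.+1 t.
Proof.
move=> t0; rewrite /flat; case: ifP => _; last by rewrite mul0r.
by rewrite exprS mulrC mulrA.
Qed.

(** At 0 the difference quotient of [flat n] is [flat n.+1], which tends to 0
    by [flat_le_lin]. *)
Lemma is_derive_flat n (t : R) :
  is_derive t 1 (flat n) (flat n.+2 t - n%:R * flat n.+1 t).
Proof.
have [t0|t0|->] := ltgtP t 0.
- rewrite {2 3}/flat ltNge (ltW t0) /= mulr0 subr0.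
  apply: (near_eq_is_derive (f := fun=> 0)).
    near=> s; rewrite /flat; case: ifPn => // s0.
    by move: s0; rewrite ltNge ltW//; near: s; exact: lt_nbhsl.
- rewrite {2 3}/flat t0.
  have tn0 : t != 0 by rewrite gt_eqF.
  have dV : is_derive t 1 (fun t : R => t^-1) (- t ^- 2).
    have := @is_deriveV R id t 1 1 tn0 (is_derive_id _ _).
    by rewrite /GRing.scale /= mulr1.
  have dE : is_derive t 1 (fun t : R => expR (- t^-1)) (expR (- t^-1) * t ^- 2).
    rewrite -[t ^- 2]opprK.
    have dN := is_deriveN dV.
    exact: (@is_derive1_comp R expR (fun t => - t^-1) t _ _ (is_derive_expR _) dN).
  have dX : is_derive t 1 (fun t : R => t^-1 ^+ n) (n%:R * t^-1 ^+ n.-1 *: (- t ^- 2)).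
    have -> : (fun t : R => t^-1 ^+ n) = (fun t : R => t^-1) ^+ n.
      by apply/funext => s; elim: n {dE} => // n IH; rewrite !exprS IH.
    exact: (is_deriveX n dV).
  have dM := is_deriveM dX dE.
  have nE : \forall s \near t,
      ((fun t : R => t^-1 ^+ n) * (fun t : R => expR (- t^-1))) s = flat n s.
    by near=> s; rewrite /flat ifT//; near: s; exact: lt_nbhsr.
  apply: is_derive_eq (near_eq_is_derive nE dM) _.
  rewrite /GRing.scale /= -exprVn.
  case: n {dX dM nE} => [|n]; rewrite /= ?exprS; ring.
- rewrite {2 3}/flat ltxx mulr0 subr0.
  suff L : h^-1 *: (flat n (h *: 1 + 0) - flat n 0) @[h --> 0^'] --> (0 : R).
    by apply: DeriveDef; [apply/cvg_ex; exists 0|exact/cvg_lim].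
  apply/cvgrPdist_le => e e0; near=> h.
  have h0 : h != 0 by near: h; exact: nbhs_dnbhs_neq.
  rewrite addr0 {2}/flat ltxx subr0 [h *: 1]mulr1 [_ *: _]mulrC flatS// sub0r normrN.
  rewrite (ger0_norm (flat_ge0 _ _)) (le_trans (flat_le_lin _ _))//.
  rewrite mulrC -ler_pdivlMr ?exprn_gt0//.
  by near: h; apply: dnbhs0_le; rewrite divr_gt0.
Unshelve. all: by end_near. Qed.

Definition crd (i : 'I_3) (x : R3) : R :=
  if i == 0%N :> nat then x.1.1 else if i == 1%N :> nat then x.1.2 else x.2.

Lemma crd_line i j (h : R) x :
  crd i (x + h *: coord_vec j) = crd i x + h * (i == j)%:R.
Proof.
by case: i => [[|[|[|//]]] ?]; case: j => [[|[|[|//]]] ?];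
  rewrite /crd /=.
Qed.

Lemma crd_continuous i : continuous (crd i).
Proof.
case: i => [[|[|[|//]]] ?] x; rewrite /crd /=.
- by apply: (@continuous_comp _ _ _ fst fst); exact: fst_continuous.
- by apply: (@continuous_comp _ _ _ fst snd); [exact: fst_continuous|exact: snd_continuous].
- exact: snd_continuous.
Qed.

(** Reduces partial derivatives of functions of a single coordinate to
    derivatives on the line. *)
Lemma is_derive_affine (G : R -> R) dG (a b : R) i j (x : R3) :
  is_derive (a + b * crd i x) 1 G dG ->
  is_derive x (coord_vec j) (fun x => G (a + b * crd i x)) (b * (i == j)%:R * dG).
Proof.
move=> GdG.
have dl : is_derive (0 : R) 1 (fun h : R => a + b * (crd i x + h * (i == j)%:R)) (b * (i == j)%:R).
  apply: is_derive_eq.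
  by rewrite /GRing.scale /=; ring.
have GdG' : is_derive (a + b * (crd i x + 0 * (i == j)%:R)) 1 G dG by rewrite mul0r addr0.
have [dh dhE] := @is_derive1_comp R G _ 0 _ _ GdG' dl.
have E : (G \o (fun h : R => a + b * (crd i x + h * (i == j)%:R))) =
   (fun h : R => G (a + b * crd i (h *: coord_vec j + x))).
  by apply/funext => h /=; rewrite [_ + x]addrC crd_line.
apply: DeriveDef.
  by apply/derivable1P; rewrite -E.
rewrite mulrC -dhE E /derive; congr (lim _).
have -> : (fun h : R => h^-1 *: (G (a + b * crd i (h *: coord_vec j + x)) - G (a + b * crd i x))) =
 (fun h : R => h^-1 *: (G (a + b * crd i ((h *: 1 + 0) *: coord_vec j + x)) -
      G (a + b * crd i (0 *: coord_vec j + x)))).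
  by apply/funext => h; rewrite addr0 [h *: 1]mulr1 scale0r add0r.
by [].
Qed.

Lemma Cn_flat_affine N n (a b : R) i : Cn N setT (fun x => flat n (a + b * crd i x)).
Proof.
elim: N n => [|N IH] n.
  split=> // x _.
  apply: (@cvg_comp _ _ _ (fun x => a + b * crd i x) (flat n)); last first.
    apply: differentiable_continuous; apply/derivable1_diffP.
    by have [] := is_derive_flat n (a + b * crd i x).
  by apply: cvgD; [exact: cvg_cst|apply: cvgM; [exact: cvg_cst|exact: crd_continuous]].
have dfl x j := is_derive_affine j (is_derive_flat n (a + b * crd i x)).
split=> [x _|j]; first exact: Cn_cont (IH n) _.
split=> [x _|]; first by have [] := dfl x j.
have oT : open [set: R3] by exact: openT.
have := CnM oT (Cn_cst N (b * (i == j)%:R) oT) (CnD oT (IH n.+2)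
   (CnM oT (Cn_cst N (- n%:R) oT) (IH n.+1))).
apply: Cn_ext => // x _; rewrite /partial.
by have [_ ->] := dfl x j; rewrite mulNr.
Qed.

(** A product of one-dimensional bumps supported in the box of radius r about
    a. It is not normalised to 1 at the centre: its value there is the same
    for all a and r, so it only changes constants. *)
Definition bump (a : R3) (r : R) (x : R3) : R :=
  \prod_(i < 3) (flat 0 (1 + r^-1 * (crd i x - crd i a)) * flat 0 (1 - r^-1 * (crd i x - crd i a))).

Lemma flat0_le1 t : flat 0 t <= 1.
Proof.
rewrite /flat; case: ifPn => // t0; rewrite mul1r -expR0 ler_expR oppr_le0.
by rewrite invr_ge0 ltW.
Qed.

Lemma smooth_bump a r : smooth setT (bump a r).
Proof.
have oT : open [set: R3] by exact: openT.
have s1 i : smooth setT (fun x => flat 0 (1 + r^-1 * (crd i x - crd i a)) *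
    flat 0 (1 - r^-1 * (crd i x - crd i a))).
  apply: smoothM => //; apply/smooth_Cn => N.
    have := Cn_flat_affine N 0 (1 - r^-1 * crd i a) r^-1 i.
    by apply: Cn_ext => // x _; congr flat; ring.
  have := Cn_flat_affine N 0 (1 + r^-1 * crd i a) (- r^-1) i.
  by apply: Cn_ext => // x _; congr flat; ring.
have := smoothM oT (s1 ord0) (smoothM oT (s1 (lift ord0 ord0)) (s1 (lift ord0 (lift ord0 ord0)))).
apply: smooth_ext => // x _.
by rewrite /bump !big_ord_recl big_ord0 mulr1.
Qed.

Lemma bump_ge0 a r x : 0 <= bump a r x.
Proof. by apply: prodr_ge0 => i _; rewrite mulr_ge0 ?flat_ge0. Qed.

Lemma bump_le1 a r x : bump a r x <= 1.
Proof.
rewrite /bump -[leRHS](@big1_eq _ 1 *%R 'I_3 (index_enum 'I_3) xpredT) /=.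
apply: ler_prod => i _; rewrite mulr_ge0 ?flat_ge0//=.
by rewrite mulr_ile1 ?flat_ge0 ?flat0_le1.
Qed.

Lemma bump_center a r : bump a r a = expR (- 6).
Proof.
rewrite /bump !big_ord_recl big_ord0 !subrr !mulr0 subr0 addr0.
rewrite /flat ltr01 invr1 expr0 mul1r mulr1 -!expRD; congr expR; ring.
Qed.

Lemma bump_eq0 a r x i : 0 < r -> r < `|crd i x - crd i a| -> bump a r x = 0.
Proof.
move=> r0 h; rewrite /bump (bigD1 i)//=.
suff -> : flat 0 (1 + r^-1 * (crd i x - crd i a)) * flat 0 (1 - r^-1 * (crd i x - crd i a)) = 0.
  by rewrite mul0r.
have rI : 1 < `|r^-1 * (crd i x - crd i a)|.
  by rewrite normrM gtr0_norm ?invr_gt0// mulrC ltr_pdivlMr// mul1r.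
move: rI; set y := _ * _; rewrite lter_normr => /orP[y1|y1].
  by rewrite mulrC /flat ifF ?mul0r//; apply/negbTE; rewrite -leNgt; lra.
by rewrite /flat ifF ?mul0r//; apply/negbTE; rewrite -leNgt; lra.
Qed.

End Bump.

(** * Quadratic forms and growth along a line *)

Section Continuity.
Variables (R : realType) (T : topologicalType).

Lemma cont_sum (I : finType) (P : pred I) (f : I -> T -> R) x :
  (forall i, P i -> {for x, continuous (f i)}) ->
  {for x, continuous (fun y => \sum_(i | P i) f i y)}.
Proof. by move=> cf; apply: (@cvg_big R^o) => //; exact: add_continuous. Qed.

Lemma cont_prod (I : finType) (P : pred I) (f : I -> T -> R) x :
  (forall i, P i -> {for x, continuous (f i)}) ->
  {for x, continuous (fun y => \prod_(i | P i) f i y)}.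
Proof. by move=> cf; apply: (@cvg_big R^o) => //; exact: mul_continuous. Qed.

Lemma cont_det n (A : T -> 'M[R]_n) x :
  (forall i j, {for x, continuous (fun y => A y i j)}) ->
  {for x, continuous (fun y => \det (A y))}.
Proof.
move=> cA; apply: cont_sum => s _; apply: cvgM; first exact: cvg_cst.
by apply: cont_prod => i _; exact: cA.
Qed.

Lemma cont_invmx n (A : T -> 'M[R]_n) x i j :
  (forall i j, {for x, continuous (fun y => A y i j)}) -> (\forall y \near x, \det (A y) != 0) ->
  {for x, continuous (fun y => invmx (A y) i j)}.
Proof.
move=> cA dA.
have E : \forall y \near x, (\det (A y))^-1 * cofactor (A y) j i = invmx (A y) i j.
  by apply: filterS dA => y dy; rewrite /invmx unitmxE unitfE dy !mxE.
rewrite /prop_for /continuous_at -(nbhs_singleton E).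
apply: cvg_trans; first exact: (near_eq_cvg E).
apply: cvgM.
  by apply: cvgV; [exact: nbhs_singleton dA|exact: cont_det].
apply: cvgM; first exact: cvg_cst.
apply: (@cont_det _ (fun y => row' j (col' i (A y)))) => k l.
have -> : (fun y => row' j (col' i (A y)) k l) = (fun y => A y (lift j k) (lift i l)).
  by apply/funext => y; rewrite !mxE.
exact: cA.
Qed.

End Continuity.

Section Quadratic_forms.
Variable R : realType.
Implicit Types (A : 'M[R]_3) (v w : 'rV[R]_3).

Definition bil A v w : R := (v *m A *m w^T) 0 0.

Lemma bilE A v w : bil A v w = \sum_(i < 3) \sum_(j < 3) v 0 i * A i j * w 0 j.
Proof.
rewrite /bil mxE exchange_big /=; apply: eq_bigr => j _.
by rewrite !mxE big_distrl.
Qed.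

Lemma bilZl A a v w : bil A (a *: v) w = a * bil A v w.
Proof. by rewrite /bil -!scalemxAl mxE. Qed.

Lemma bilZr A a v w : bil A v (a *: w) = a * bil A v w.
Proof. by rewrite /bil linearZ /= -scalemxAr mxE. Qed.

Lemma bilDl A u v w : bil A (u + v) w = bil A u w + bil A v w.
Proof. by rewrite /bil !mulmxDl mxE. Qed.

Lemma bilDr A u v w : bil A u (v + w) = bil A u v + bil A u w.
Proof. by rewrite /bil linearD /= mulmxDr mxE. Qed.

Lemma bilC A v w : A^T = A -> bil A v w = bil A w v.
Proof.
move=> sA; rewrite !bilE exchange_big /=; apply: eq_bigr => i _; apply: eq_bigr => j _.
by rewrite -{1}sA mxE; ring.
Qed.

Lemma posdef_ge0 A v : posdef A -> 0 <= bil A v v.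
Proof.
move=> pA; have [->|v0] := eqVneq v 0; last exact/ltW/pA.
by rewrite /bil !mul0mx mxE.
Qed.

Lemma bil_CauchySchwarz A v w : A^T = A -> posdef A ->
  bil A v w ^+ 2 <= bil A v v * bil A w w.
Proof.
move=> sA pA; have [->|w0] := eqVneq w 0.
  by rewrite -[0](scale0r 0) !bilZr !mul0r expr0n mulr0.
have ww : 0 < bil A w w by exact: pA.
have := posdef_ge0 (v + (- (bil A v w / bil A w w)) *: w) pA.
rewrite !(bilDl, bilDr) !(bilZl, bilZr) (bilC w v sA).
set a := bil A v v; set b := bil A v w; set c := bil A w w => h.
rewrite -subr_ge0.
suff -> : a * c - b ^+ 2 = c * (a + - (b / c) * b + (- (b / c) * b + - (b / c) * (- (b / c) * c))).
  by rewrite mulr_ge0 // ltW.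
by field; rewrite gt_eqF.
Qed.

Lemma bil_invmx A v w : A \in unitmx -> bil A (v *m invmx A) (w *m invmx A) = bil (invmx A)^T v w.
Proof.
by move=> uA; rewrite /bil trmx_mul mulmxKV// mulmxA.
Qed.

Lemma posdef_invmx A : A^T = A -> posdef A -> posdef (invmx A).
Proof.
move=> sA pA v v0; have uA : A \in unitmx by rewrite unitmxE unitfE posdef_det_neq0.
have := pA (v *m invmx A); rewrite -/(bil A _ _) bil_invmx// trmx_inv sA; apply.
by apply: contra v0 => /eqP h; rewrite -[v](mulmxKV uA) h mul0mx.
Qed.

Lemma bil_delta A i j : bil A (delta_mx 0 i) (delta_mx 0 j) = A i j.
Proof. by rewrite /bil -rowE trmx_delta -colE !mxE. Qed.

Lemma entry_bound A i j : A^T = A -> posdef A ->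
  `|A i j| <= A i i + A j j.
Proof.
move=> sA pA; have := bil_CauchySchwarz (delta_mx 0 i) (delta_mx 0 j) sA pA.
have p k : 0 <= A k k by rewrite -bil_delta posdef_ge0.
rewrite !bil_delta => h; have pi := p i; have pj := p j.
rewrite -(@ler_pXn2r _ 2)// ?nnegrE ?addr_ge0// real_normK ?num_real//.
by apply: (le_trans h); nra.
Qed.

(** Inversion reverses the order of positive definite forms. With v1 = v A^-1
    and v2 = v B^-1 one has B^-1 (v, v) = A (v1, v2), and Cauchy-Schwarz for A
    bounds its square by A^-1 (v, v) A (v2, v2). *)
Lemma inverse_order A B v a : A^T = A -> B^T = B -> posdef A -> posdef B -> 0 <= a ->
  (forall u, bil A u u <= a * bil B u u) ->
  bil (invmx B) v v <= a * bil (invmx A) v v.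
Proof.
move=> sA sB pA pB a0 AB.
have uA : A \in unitmx by rewrite unitmxE unitfE posdef_det_neq0.
have uB : B \in unitmx by rewrite unitmxE unitfE posdef_det_neq0.
set v1 := v *m invmx A; set v2 := v *m invmx B.
have e1 : bil A v1 v2 = bil (invmx B) v v.
  by rewrite /bil mulmxKV// trmx_mul trmx_inv sB mulmxA.
have e2 : bil A v1 v1 = bil (invmx A) v v by rewrite bil_invmx// trmx_inv sA.
have e3 : bil B v2 v2 = bil (invmx B) v v by rewrite bil_invmx// trmx_inv sB.
have := bil_CauchySchwarz v1 v2 sA pA; rewrite e1 e2.
have := AB v2; rewrite e3.
have := posdef_ge0 v (posdef_invmx sA pA); have := posdef_ge0 v (posdef_invmx sB pB).
set p := bil (invmx B) v v; set q := bil (invmx A) v v; set r := bil A v2 v2 => p0 q0 rp pq.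
have [->|pn0] := eqVneq p 0; first by rewrite mulr_ge0.
have pp : 0 < p by rewrite lt0r pn0.
rewrite -(ler_pM2r pp) -expr2 (le_trans pq)// mulrAC (mulrC (a * p)).
by rewrite ler_wpM2l.
Qed.

Lemma det_bound A m : (forall i j, `|A i j| <= m) -> `|\det A| <= 6 * m ^+ 3.
Proof.
move=> Am; rewrite /determinant (le_trans (ler_norm_sum _ _ _))//.
apply: (le_trans (y := \sum_(s : 'S_3) m ^+ 3)); last first.
  by rewrite sumr_const card_Sn mulr_natl.
apply: ler_sum => s _; rewrite normrM normrX normrN1 expr1n mul1r normr_prod.
apply: (le_trans (y := \prod_(i < 3) m)); last by rewrite prodr_const card_ord.
by apply: ler_prod => i _; rewrite normr_ge0 Am.
Qed.

End Quadratic_forms.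

Section Gronwall.
Variable R : realType.

(** For t >= s because exp (-c t) q is nonincreasing, for t < s because exp (c
    t) q is nondecreasing. *)
Lemma gronwall (q dq : R -> R) c s t : 0 <= c ->
  (forall t : R, is_derive t 1 q (dq t)) -> (forall t, `|dq t| <= c * q t) ->
  q t <= expR (c * `|t - s|) * q s.
Proof.
move=> c0 qd qc.
have dE (a r : R) : is_derive r 1 (fun t => expR (a * t) * q t) (expR (a * r) * (a * q r + dq r)).
  have dl : is_derive r 1 (fun t : R => a * t) a.
    by apply: is_derive_eq; rewrite /GRing.scale /= mulr1.
  have de := @is_derive1_comp R expR _ r _ _ (is_derive_expR _) dl.
  apply: (is_derive_eq (is_deriveM de (qd r))).
  by rewrite /GRing.scale /=; ring.
have ce (a : R) I : {within I, continuous (fun t => expR (a * t) * q t)}.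
  apply: continuous_subspaceT => r; apply: differentiable_continuous.
  by apply/derivable1_diffP; have [] := dE a r.
have dd (a r : R) : derivable (fun t => expR (a * t) * q t) r 1 by have [] := dE a r.
have de (a r : R) : derive1 (fun t => expR (a * t) * q t) r = expR (a * r) * (a * q r + dq r).
  by rewrite derive1E; have [] := dE a r.
have key (a : R) : expR (a * t) * q t <= expR (a * s) * q s -> q t <= expR (a * (s - t)) * q s.
  move=> h; rewrite mulrBr expRD expRN mulrAC -ler_pdivrMr ?invr_gt0 ?expR_gt0//.
  by rewrite invrK mulrC.
have [st|ts] := leP s t.
  have := @ler0_derive1_nincry R (fun t => expR (- c * t) * q t) s.
  move=> /(_ _ _ (ce _ _) s t (lexx _) st) h.
  have := key (- c) (h _ _); rewrite mulNr -mulrN opprB ger0_norm ?subr_ge0//; apply => // r _.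
  rewrite de pmulr_rle0 ?expR_gt0//.
  by have := qc r; rewrite ler_norml => /andP[]; lra.
have := @ger0_derive1_ndecrNy R (fun t => expR (c * t) * q t) s.
move=> /(_ _ _ (ce _ _) t s (ltW ts) (lexx _)) h.
have := key c (h _ _); rewrite distrC ger0_norm ?subr_ge0 ?(ltW ts)//; apply => // r _.
rewrite de pmulr_rge0 ?expR_gt0//.
by have := qc r; rewrite ler_norml => /andP[]; lra.
Qed.

End Gronwall.

(** * The derivative of the metric along e3 *)

Section Boxes.
Variable R : realType.
Local Notation R3 := (R * R * R)%type.

Definition cbox (a : R3) (r : R) : set R3 :=
  (`[a.1.1 - r, a.1.1 + r] `*` `[a.1.2 - r, a.1.2 + r]) `*` `[a.2 - r, a.2 + r].

Lemma cbox_compact a r : compact (cbox a r).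
Proof. by apply: compact_setX; [apply: compact_setX|]; exact: segment_compact. Qed.

Lemma cboxP a r x : cbox a r x <-> forall i, `|crd i x - crd i a| <= r.
Proof.
have E (u v : R) : (u \in `[v - r, v + r]) = (`|u - v| <= r).
  by rewrite in_itv /= ler_norml lerBrDl addrC lerBlDl; congr (_ && _); rewrite addrC lerBlDr.
split=> [[[/=]]|h].
  rewrite !E => h1 h2 h3 i; case: i => [[|[|[|//]]] ?]; by rewrite /crd /=.
by split; [split|]; rewrite /= E; [have := h ord0|have := h (lift ord0 ord0)|have := h ord_max].
Qed.

Lemma cbox_sub_ball a r e : r < e -> cbox a r `<=` ball a e.
Proof.
move=> re x /cboxP h; split; [split|]; rewrite -ball_normE /ball_ /= distrC (le_lt_trans _ re)//.
- exact: (h ord0).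
- exact: (h (lift ord0 ord0)).
- exact: (h ord_max).
Qed.

End Boxes.

Section Metric.
Variables (R : realType) (Omega : set (R * R * R)) (g : R * R * R -> 'M[R]_3).
Hypotheses (oO : open Omega) (gR : riemannian_metric Omega g).

Lemma metric_sym x : Omega x -> (g x)^T = g x.
Proof. by move=> Ox; have [_ /(_ x Ox)[]] := gR. Qed.

Lemma metric_posdef x : Omega x -> posdef (g x).
Proof. by move=> Ox; have [_ /(_ x Ox)[]] := gR. Qed.

Lemma metric_det_gt0 x : Omega x -> 0 < \det (g x).
Proof. by move=> Ox; apply: posdef_det_gt0; exact: metric_posdef. Qed.

Lemma metric_unit x : Omega x -> g x \in unitmx.
Proof. by move=> Ox; rewrite unitmxE unitfE gt_eqF// metric_det_gt0. Qed.

Lemma metric_smooth i j : smooth Omega (fun x => g x i j).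
Proof. by have [+ _] := gR; exact. Qed.

Lemma metric_cont i j x : Omega x -> {for x, continuous (fun x => g x i j)}.
Proof. exact/smooth_cont/metric_smooth. Qed.

Lemma invmetric_cont i j x : Omega x -> {for x, continuous (fun x => invmx (g x) i j)}.
Proof.
move=> Ox; apply: cont_invmx => [k l|]; first exact: metric_cont.
have := open_nbhs_nbhs (conj oO Ox); apply: filterS => y Oy.
by rewrite gt_eqF// metric_det_gt0.
Qed.

Lemma vol_density_cont x : Omega x -> {for x, continuous (vol_density g)}.
Proof.
move=> Ox; apply: (@continuous_comp _ _ _ (fun x => \det (g x)) Num.sqrt).
  by apply: cont_det => i j; exact: metric_cont.
exact: sqrt_continuous.
Qed.

Definition d3metric (x : R * R * R) : 'M[R]_3 :=
  \matrix_(i, j) partial ord_max (fun y => g y i j) x.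

(** The endomorphism w |-> nabla_w e3; the derivative of the constant
    components of e3 vanishes and only the Christoffel symbols remain, see
    [cov_der_e3]. *)
Definition nablae3 (x : R * R * R) (w : 'rV[R]_3) : 'rV[R]_3 :=
  \row_i \sum_(j < 3) christoffel g i j ord_max x * w 0 j.

Lemma cov_der_e3 (Y : vfield) x : cov_der g Y e3 x = nablae3 x (Y x).
Proof.
apply/rowP => i; rewrite mxE [RHS]mxE big1 ?add0r => [|j _]; last first.
  by rewrite /partial derive_cst mulr0.
apply: eq_bigr => j _; rewrite (bigD1 ord_max)//= big1 ?addr0 => [|l lm].
  by rewrite /e3 mxE !eqxx mulr1.
by rewrite /e3 mxE (negbTE lm) andbF mulr0.
Qed.

Lemma nablae3Z x a w : nablae3 x (a *: w) = a *: nablae3 x w.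
Proof.
apply/rowP => i; rewrite mxE [in RHS]mxE [in RHS]mxE big_distrr; apply: eq_bigr => j _ /=.
by rewrite mxE mulrCA.
Qed.

(** Koszul's formula: in the symmetric combination of the Christoffel symbols
    the two derivatives along w cancel each other, and the derivative of the
    metric along e3 is left. *)
Lemma nablae3_pairing x w : Omega x -> bil (g x) (nablae3 x w) w = 2^-1 * bil (d3metric x) w w.
Proof.
move=> Ox; pose b : 'rV[R]_3 := \row_m \sum_(j < 3) w 0 j *
  (partial j (fun y => g y m ord_max) x + partial ord_max (fun y => g y m j) x
     - partial m (fun y => g y j ord_max) x).
have -> : nablae3 x w = 2^-1 *: (b *m invmx (g x)).
  apply/rowP => i; rewrite mxE [RHS]mxE [X in _ * X]mxE big_distrr /= /christoffel.
  under [RHS]eq_bigr do rewrite mxE big_distrl big_distrr /=.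
  rewrite exchange_big; apply: eq_bigr => j _ /=; rewrite -mulrA big_distrl big_distrr /=.
  apply: eq_bigr => m _; rewrite -{1}(invmx_sym (metric_sym Ox)) mxE; ring.
rewrite bilZl; congr (_ * _).
have -> : bil (g x) (b *m invmx (g x)) w = (b *m w^T) 0 0.
  by rewrite /bil mulmxKV// metric_unit.
rewrite bilE mxE.
under eq_bigr do rewrite !mxE big_distrl /=.
have E : \sum_(i < 3) \sum_(j < 3) w 0 j * partial j (fun y => g y i ord_max) x * w 0 i =
  \sum_(i < 3) \sum_(j < 3) w 0 j * partial i (fun y => g y j ord_max) x * w 0 i.
  by rewrite exchange_big; apply: eq_bigr => i _; apply: eq_bigr => j _; ring.
under eq_bigr do under eq_bigr do rewrite mulrBr mulrDr mulrBl mulrDl.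
under eq_bigr do rewrite sumrB big_split /=.
rewrite sumrB big_split /= E addrAC subrr add0r.
by apply: eq_bigr => i _; apply: eq_bigr => j _; rewrite mxE; ring.
Qed.

Hypothesis bounded_nablae3 :
  (ereal_sup [set supnorm Omega g (cov_der g Y e3) | Y in
     [set Y : vfield | [/\ smooth_vfield Omega Y, csupport_in Omega Y &
                           (supnorm Omega g Y <= 1)%E]]] < +oo)%E.

(** The hypothesis only speaks of compactly supported fields of norm at most
    1. Such a field is obtained from the constant field w by cutting it off
    near x, where the norm of w is still below 1; dividing by the value of the
    bump at its centre gives the factor exp 6. *)
Lemma nablae3_bound : exists2 C : R, 0 <= C & forall x w, Omega x ->
  bil (g x) w w < 1 -> Defs.gnorm g x (nablae3 x w) <= C.
Proof.
have [C0 C0E] : exists C : R, (ereal_sup [set supnorm Omega g (cov_der g Y e3) | Y in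
     [set Y : vfield | [/\ smooth_vfield Omega Y, csupport_in Omega Y &
                           (supnorm Omega g Y <= 1)%E]]] <= C%:E)%E.
  move: bounded_nablae3; case: (ereal_sup _) => [r| |] // _; first by exists r.
  by exists 0; rewrite leNye.
exists (expR 6 * `|C0|); first by rewrite mulr_ge0// expR_ge0.
move=> x w Ox w1.
have cw : {for x, continuous (fun y => bil (g y) w w)}.
  have -> : (fun y => bil (g y) w w) = (fun y => \sum_(i < 3) \sum_(j < 3) w 0 i * g y i j * w 0 j).
    by apply/funext => y; rewrite bilE.
  apply: cont_sum => i _; apply: cont_sum => j _.
  by apply: cvgM; [apply: cvgM; [exact: cvg_cst|exact: metric_cont]|exact: cvg_cst].
have : \forall y \near x, Omega y /\ bil (g y) w w < 1.
  near=> y; split.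
    by near: y; exact: open_nbhs_nbhs.
  by near: y; apply: (cvgr_lt _ cw).
move=> /nbhs_ballP[rho /= rho0 rhoP].
pose r := rho / 2.
have r0 : 0 < r by rewrite divr_gt0.
have rr : r < rho by rewrite /r ltr_pdivrMr// ltr_pMr// ltr1n.
pose Y : vfield := fun y => bump x r y *: w.
have YE y : ~ cbox x r y -> Y y = 0.
  move=> /cboxP/existsNP[i /negP]; rewrite -ltNge => h.
  by rewrite /Y (bump_eq0 _ h)// scale0r.
have smY : smooth_vfield Omega Y.
  move=> i; have sb : smooth Omega (bump x r) by apply: smooth_sub (smooth_bump x r).
  by apply: smooth_ext (smoothM oO sb (smooth_cst (w 0 i) oO)) => // y _; rewrite /Y mxE.
have csY : csupport_in Omega Y.
  exists (cbox x r); split; first exact: cbox_compact.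
    by move=> y /(cbox_sub_ball rr) /rhoP[].
  by move=> y _; exact: YE.
have nY : (supnorm Omega g Y <= 1)%E.
  apply: ge_ereal_sup => _ [y Oy <-]; rewrite lee_fin.
  have [yb|/YE ->] := pselect (cbox x r y); last first.
    by rewrite /Defs.gnorm !mul0mx mxE sqrtr0 ler01.
  rewrite /Defs.gnorm -[X in Num.sqrt X]/(bil _ _ _) bilZl bilZr mulrA -expr2.
  rewrite -[leRHS]sqrtr1 ler_wsqrtr// mulr_ile1 ?sqr_ge0//.
  - exact/posdef_ge0/metric_posdef.
  - by rewrite expr_le1 ?bump_ge0 ?bump_le1.
  - by have [_ /ltW] := rhoP _ (cbox_sub_ball rr yb).
have h1 : (supnorm Omega g (cov_der g Y e3) <= C0%:E)%E.
  by apply: le_trans C0E; apply: ereal_sup_ubound; exists Y.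
have : ((Defs.gnorm g x (cov_der g Y e3 x))%:E <= C0%:E)%E.
  by apply: le_trans h1; apply: ereal_sup_ubound; exists x.
rewrite lee_fin cov_der_e3 nablae3Z bump_center.
rewrite /Defs.gnorm -[X in Num.sqrt X]/(bil _ _ _) bilZl bilZr mulrA -expr2.
rewrite sqrtrM ?sqr_ge0// sqrtr_sqr gtr0_norm ?expR_gt0// expRN => h2.
rewrite -ler_pdivrMl ?expR_gt0// (le_trans h2)// ler_norm//.
Unshelve. all: by end_near. Qed.

(** Rescale v to norm 1 / sqrt 2, so that [nablae3_bound] applies, and use
    Cauchy-Schwarz in [nablae3_pairing]. *)
Lemma d3metric_bound : exists2 c : R, 0 <= c & forall x v, Omega x ->
  `|bil (d3metric x) v v| <= c * bil (g x) v v.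
Proof.
have [C C0 CP] := nablae3_bound.
exists (4 * C); first by rewrite mulr_ge0.
move=> x v Ox; have [->|v0] := eqVneq v 0.
  by rewrite -[0](scale0r 0) !bilZl !mul0r mulr0 normr0.
have pg := metric_posdef Ox; have sg := metric_sym Ox.
have q0 : 0 < bil (g x) v v by exact: pg.
set q := bil (g x) v v in q0 *.
pose s := (Num.sqrt (2 * q))^-1; pose w := s *: v.
have s2 : s ^+ 2 = (2 * q)^-1 by rewrite exprVn sqr_sqrtr// mulr_ge0// ltW.
have qw : bil (g x) w w = 2^-1.
  by rewrite bilZl bilZr mulrA -expr2 s2 -/q; field; rewrite gt_eqF.
have w1 : bil (g x) w w < 1 by rewrite qw invf_lt1 ?ltr1n.
have := CP x w Ox w1; rewrite /Defs.gnorm -[X in Num.sqrt X]/(bil _ _ _) => h.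
have := bil_CauchySchwarz (nablae3 x w) w sg pg; rewrite nablae3_pairing// qw.
have : bil (g x) (nablae3 x w) (nablae3 x w) <= C ^+ 2.
  rewrite -[leLHS]sqr_sqrtr; last exact: posdef_ge0.
  by rewrite lerXn2r// nnegrE ?sqrtr_ge0.
set N := bil (g x) _ _ => NC cs.
have dw : `|bil (d3metric x) w w| <= 2 * C.
  rewrite -(@ler_pXn2r _ 2)// ?nnegrE ?mulr_ge0// real_normK ?num_real//.
  by move: cs; rewrite !exprMn => cs; nra.
move: dw; rewrite bilZl bilZr mulrA -expr2 s2 normrM ger0_norm; last first.
  by rewrite invr_ge0 mulr_ge0// ltW.
rewrite mulrC ler_pdivrMr ?mulr_gt0// => /le_trans; apply.
by rewrite le_eqVlt; apply/orP; left; apply/eqP; ring.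
Qed.

End Metric.

(** * Growth of the metric along vertical lines *)

Lemma compact_cont_bounded (R : realType) (T : topologicalType) (f : T -> R) (K : set T) :
  compact K -> (forall x, K x -> {for x, continuous f}) ->
  exists2 M : R, 0 <= M & forall x, K x -> `|f x| <= M.
Proof.
move=> cK cf; have [->|K0] := eqVneq K set0; first by exists 0.
have [|//||c cKc cM] := @compact_EVT_max T R (fun x => `|f x|) K.
- exact/set0P.
- apply: continuous_in_subspaceT => x /set_mem Kx.
  apply: (@continuous_comp _ _ _ f Num.norm); first exact: cf.
  exact: norm_continuous.
by exists `|f c| => // x Kx; apply: cM; exact/mem_set.
Qed.

Section Cylinder.
Variables (R : realType) (Sigma : set (R * R)) (g : R * R * R -> 'M[R]_3).
Let Omega : set (R * R * R) := Sigma `*` [set: R].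
Hypothesis oS : open Sigma.

Lemma cylinder_open : open Omega.
Proof.
have -> : Omega = fst @^-1` Sigma.
  by apply/seteqP; split => [x []//|x Sx]; split.
by apply: open_comp => // x _; exact: fst_continuous.
Qed.

Hypothesis gR : riemannian_metric Omega g.

Lemma vline (x : R * R * R) (s : R) : x + s *: coord_vec ord_max = (x.1, x.2 + s).
Proof.
case: x => -[a b] c; apply/pair_equal_spec; split => /=; last by rewrite [_ *: _]mulr1.
by apply/pair_equal_spec; split; rewrite /= [_ *: _]mulr0 addr0.
Qed.

Lemma is_derive_vline (f : R * R * R -> R) p (t : R) : derivable f (p, t) (coord_vec ord_max) ->
  is_derive t 1 (fun s => f (p, s)) (partial ord_max f (p, t)).
Proof.
have E s : ((p, 0) : R * R * R) + s *: coord_vec ord_max = (p, s) by rewrite vline add0r.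
move=> df; have := @is_derive_line _ f (p, 0) (coord_vec ord_max) t.
rewrite E => /(_ df).
by have -> : (fun s => f (((p, 0) : R * R * R) + s *: coord_vec ord_max)) = (fun s => f (p, s))
  by apply/funext => s; rewrite E.
Qed.

Lemma is_derive_bil_metric p v (t : R) : Sigma p ->
  is_derive t 1 (fun t => bil (g (p, t)) v v) (bil (d3metric g (p, t)) v v).
Proof.
move=> Sp.
have -> : (fun t => bil (g (p, t)) v v) =
    (fun t => \sum_(i < 3) \sum_(j < 3) v 0 i * g (p, t) i j * v 0 j).
  by apply/funext => s; rewrite bilE.
rewrite bilE; apply: is_derive_sumf => i; apply: is_derive_sumf => j.
have dg : is_derive t 1 (fun t => g (p, t) i j) (d3metric g (p, t) i j).
  rewrite mxE; apply: is_derive_vline; apply: smooth_derivable; first exact: (metric_smooth gR).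
  by split.
have -> : (fun t => v 0 i * g (p, t) i j * v 0 j) = (v 0 i * v 0 j) *: (fun t => g (p, t) i j).
  by apply/funext => s; rewrite scalrfctE /GRing.scale /=; ring.
apply: (is_derive_eq (is_deriveZ _ dg)).
by rewrite /GRing.scale /=; ring.
Qed.

Hypothesis bounded_nablae3 :
  (ereal_sup [set supnorm Omega g (cov_der g Y e3) | Y in
     [set Y : vfield | [/\ smooth_vfield Omega Y, csupport_in Omega Y &
                           (supnorm Omega g Y <= 1)%E]]] < +oo)%E.

(** Gronwall's inequality compares the metric at height t with the metric at
    height 0, where it is bounded over the compact K; [inverse_order] passes
    to the inverse, and the volume density is bounded through the entries of
    g, three at a time. *)
Lemma metric_growth : exists2 c : R, 0 <= c &
  forall K, compact K -> K `<=` Sigma -> exists2 M : R, 0 <= M & forall p t, K p ->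
    (forall i j, `|invmx (g (p, t)) i j| <= M * expR (c * `|t|)) /\
    vol_density g (p, t) <= M * expR (3 * c * `|t|).
Proof.
have oO := cylinder_open.
have [c c0 cP] := d3metric_bound oO gR bounded_nablae3.
exists c => // K cK KS.
pose F p := \sum_(i < 3) (g (p, 0) i i + invmx (g (p, 0)) i i).
have O0 p t : Sigma p -> Omega (p, t) by split.
have cF p : K p -> {for p, continuous F}.
  move=> /KS Sp; apply: cont_sum => i _.
  have cp : {for p, continuous (fun p : R * R => (p, 0 : R))}.
    apply: (@cvg_pair _ _ _ (nbhs p) (nbhs p) (nbhs (0 : R))); [exact: cvg_id|exact: cvg_cst].
  apply: cvgD.
    apply: (@continuous_comp _ _ _ (fun p => (p, 0)) (fun x => g x i i)) => //.
    exact/(metric_cont gR)/O0.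
  apply: (@continuous_comp _ _ _ (fun p => (p, 0)) (fun x => invmx (g x) i i)) => //.
  exact/(invmetric_cont oO gR)/O0.
have [m m0 mP] := compact_cont_bounded cK cF.
have gr p v s t : Sigma p -> bil (g (p, t)) v v <= expR (c * `|t - s|) * bil (g (p, s)) v v.
  move=> Sp; apply: (@gronwall _ (fun t => bil (g (p, t)) v v)
    (fun t => bil (d3metric g (p, t)) v v)) => // r.
    exact: is_derive_bil_metric.
  exact/cP/O0.
have Pg p t : Sigma p -> posdef (g (p, t)) by move=> Sp; exact/(metric_posdef gR)/O0.
have Sg p t : Sigma p -> (g (p, t))^T = g (p, t) by move=> Sp; exact/(metric_sym gR)/O0.
have giiE (A : 'M[R]_3) i : A i i = bil A (delta_mx 0 i) (delta_mx 0 i) by rewrite bil_delta.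
have dg p i : K p -> g (p, 0) i i <= m /\ invmx (g (p, 0)) i i <= m.
  move=> Kp; have Sp := KS p Kp; have := mP p Kp.
  have n0 j : 0 <= g (p, 0) j j + invmx (g (p, 0)) j j.
    rewrite !giiE addr_ge0// posdef_ge0//; first exact: Pg.
    by apply: posdef_invmx; [exact: Sg|exact: Pg].
  rewrite ger0_norm ?sumr_ge0// /F (bigD1 i)//= => h.
  have a0 : 0 <= g (p, 0) i i by rewrite giiE posdef_ge0//; exact: Pg.
  have b0 : 0 <= invmx (g (p, 0)) i i.
    by rewrite giiE posdef_ge0//; apply: posdef_invmx; [exact: Sg|exact: Pg].
  have s0 : 0 <= \sum_(j < 3 | j != i) (g (p, 0) j j + invmx (g (p, 0)) j j) by rewrite sumr_ge0.
  by split; lra.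
have gb p t i j : K p -> `|g (p, t) i j| <= 2 * m * expR (c * `|t|).
  move=> Kp; have Sp := KS p Kp.
  apply: (le_trans (entry_bound _ _ (Sg _ _ Sp) (Pg _ _ Sp))).
  have h k : g (p, t) k k <= m * expR (c * `|t|).
    rewrite giiE (le_trans (gr p _ 0 t Sp))// subr0 mulrC bil_delta ler_wpM2r ?expR_ge0//.
    by have [] := dg p k Kp.
  by have := h i; have := h j; lra.
have ib p t i j : K p -> `|invmx (g (p, t)) i j| <= 2 * m * expR (c * `|t|).
  move=> Kp; have Sp := KS p Kp.
  have sI : (invmx (g (p, t)))^T = invmx (g (p, t)) by rewrite trmx_inv Sg.
  apply: (le_trans (entry_bound _ _ sI (posdef_invmx (Sg _ _ Sp) (Pg _ _ Sp)))).
  have h k : invmx (g (p, t)) k k <= m * expR (c * `|t|).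
    rewrite giiE (le_trans (inverse_order (delta_mx 0 k) (Sg p 0 Sp) (Sg p t Sp)
      (Pg p 0 Sp) (Pg p t Sp) (expR_ge0 (c * `|t|)) _))//.
      by move=> u; have := gr p u t 0 Sp; rewrite sub0r normrN.
    by rewrite mulrC bil_delta ler_wpM2r ?expR_ge0//; have [] := dg p k Kp.
  by have := h i; have := h j; lra.
pose M := 1 + 2 * m + 6 * (2 * m) ^+ 3.
have m3 : 0 <= m ^+ 3 by rewrite exprn_ge0.
have M1 : 1 <= M by rewrite /M exprMn; lra.
have M2 : 2 * m <= M by rewrite /M exprMn; lra.
exists M => [|p t Kp]; first lra.
split=> [i j|].
  by rewrite (le_trans (ib _ _ _ _ Kp))// ler_wpM2r// expR_ge0.
have e1 : 1 <= expR (3 * c * `|t|) by rewrite -expR0 ler_expR !mulr_ge0.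
have d0 : 0 < \det (g (p, t)) by apply: (metric_det_gt0 gR); exact/O0/KS.
have db : \det (g (p, t)) <= 6 * (2 * m) ^+ 3 * expR (3 * c * `|t|).
  rewrite (le_trans (ler_norm _))// (le_trans (det_bound (m := 2 * m * expR (c * `|t|)) _))//.
    by move=> i j; exact: gb.
  by rewrite [(2 * m * _) ^+ 3]exprMn -expRM_natl !mulrA.
have vd : vol_density g (p, t) <= 1 + \det (g (p, t)).
  rewrite /vol_density -[leRHS]ger0_norm; last by rewrite addr_ge0// ltW.
  rewrite -sqrtr_sqr ler_wsqrtr//; nra.
apply: (le_trans vd); apply: (le_trans (lerD e1 db)).
have e0 := expR_ge0 (3 * c * `|t|).
rewrite /M; nra.
Qed.

End Cylinder.

(** * Integration over space *)

(** Named so that it can carry the sigma-finite structure that Fubini's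
    theorem asks of it. *)
Definition lebesgue2 (R : realType) := (@lebesgue_measure R \x @lebesgue_measure R)%E.
HB.instance Definition _ (R : realType) := Measure.on (@lebesgue2 R).
Fact lebesgue2_sigma_finite (R : realType) : sigma_finite setT (@lebesgue2 R).
Proof.
have /sigma_finiteP[F [TF ndF Foo]] := sigma_finiteT (@lebesgue_measure R).
exists (fun n => F n `*` F n).
  rewrite -setXTT TF predeqE => -[x y]; split.
    move=> [/= [n _ Fnx] [k _ Gky]]; exists (maxn n k) => //; split.
    - by move: x Fnx; exact/subsetPset/ndF/leq_maxl.
    - by move: y Gky; exact/subsetPset/ndF/leq_maxr.
  by move=> [n _ []/= ? ?]; split; exists n.
move=> k; have [? ?] := Foo k.
split; first exact: measurableX.
by rewrite /lebesgue2 product_measure1E// lte_mul_pinfty// ge0_fin_numE.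
Qed.
HB.instance Definition _ (R : realType) := 
  Measure_isSigmaFinite.Build _ _ _ (@lebesgue2 R) (lebesgue2_sigma_finite R).
HB.instance Definition _ (R : realType) := Measure.on (@lebesgue3 R).

Section Measure.
Variable R : realType.
Local Notation R3 := (R * R * R)%type.
Local Notation lam := (@lebesgue_measure R).

(** An open set is the union of the balls that it contains with rational
    centre and radius 1 / (n + 1), and a ball of the product is a box. *)
Lemma open_measurable3 (U : set R3) : open U -> measurable U.
Proof.
move=> oU.
pose q3 (q : rat * rat * rat) : R3 := (ratr q.1.1, ratr q.1.2, ratr q.2).
pose F (i : rat * rat * rat * nat) : set R3 :=
  if `[< ball (q3 i.1) (i.2.+1%:R^-1 : R) `<=` U >] then ball (q3 i.1) (i.2.+1%:R^-1 : R) else set0.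
have -> : U = \bigcup_i F i.
  apply/seteqP; split => [x Ux|x [i _]]; last first.
    by rewrite /F; case: asboolP => // + bx; exact.
  have [e /= e0 eU] := (nbhs_ballP _ _).1 (open_nbhs_nbhs (conj oU Ux)).
  have [n nE] : exists n : nat, 2 / e < n.+1%:R by exists (Num.truncn (2 / e)); exact: truncnS_gt.
  have ne : 2 * n.+1%:R^-1 < e :> R.
    by rewrite ltr_pdivrMr// mulrC -ltr_pdivrMr.
  have n0 : 0 < n.+1%:R^-1 :> R by rewrite invr_gt0.
  have qx (y : R) : exists q : rat, `|y - ratr q| < n.+1%:R^-1.
    have /rat_in_itvoo[q] : y - n.+1%:R^-1 < y by rewrite ltrBlDl ltrDr.
    rewrite in_itv /= => /andP[q1 q2]; exists q.
    by rewrite gtr0_norm ?subr_gt0// ltrBlDl addrC -ltrBlDl.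
  have [q1 h1] := qx x.1.1; have [q2 h2] := qx x.1.2; have [q3' h3] := qx x.2.
  have bx : ball (q3 (q1, q2, q3')) (n.+1%:R^-1 : R) x.
    by apply: ball_sym; split; [split|]; rewrite -ball_normE.
  exists (q1, q2, q3', n) => //; rewrite /F /=; case: asboolP => // nb; case: nb => y yb.
  apply: eU; apply: le_ball (ball_triangle (ball_sym bx) yb).
  by rewrite (_ : _ + _ = 2 * n.+1%:R^-1) ?ltW//; ring.
apply: countable_bigcupT_measurable => // i; rewrite /F; case: asboolP => // _.
have -> : ball (q3 i.1) (i.2.+1%:R^-1 : R) =
    (ball (q3 i.1).1.1 (i.2.+1%:R^-1 : R) `*` ball (q3 i.1).1.2 (i.2.+1%:R^-1 : R))
      `*` ball (q3 i.1).2 (i.2.+1%:R^-1 : R).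
  by apply/seteqP; split => x [] [].
by apply: measurableX; [apply: measurableX|]; exact: measurable_ball.
Qed.

Lemma cont_measurable3 (U : set R3) (f : R3 -> R) : open U ->
  (forall x, U x -> {for x, continuous f}) -> measurable_fun U f.
Proof.
move=> oU cf; apply: (measurability _ (RGenOInfty.measurableE R)).
move=> /= _ [_ [a ->] <-]; apply: open_measurable3.
rewrite openE => x [Ux fx]; rewrite /interior /=.
near=> y; split; first by near: y; exact: open_nbhs_nbhs.
rewrite /= in_itv /= andbT; near: y; apply: (cvgr_gt _ (cf x Ux)).
by move: fx; rewrite /= in_itv /= andbT.
Unshelve. all: by end_near. Qed.

Lemma integral_expRN (a : R) : 0 < a ->
  (\int[lam]_(x in `[0%R : R, +oo[) (expR (- (a * x)))%:E = (a^-1)%:E)%E.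
Proof.
move=> a0.
have dl (x : R) : is_derive x 1 (fun x : R => - (a * x)) (- a).
  by apply: is_derive_eq; rewrite /GRing.scale /= mulr1.
have de (x : R) : is_derive x 1 (fun x : R => expR (- (a * x))) (expR (- (a * x)) * - a).
  exact: (@is_derive1_comp R expR _ x _ _ (is_derive_expR _) (dl x)).
have dF (x : R) : is_derive x 1 (fun x : R => - a^-1 * expR (- (a * x))) (expR (- (a * x))).
  apply: (is_derive_eq (is_deriveZ (- a^-1) (de x))).
  by rewrite /GRing.scale /=; field; rewrite gt_eqF.
have cE : continuous (fun x : R => expR (- (a * x))).
  by move=> x; apply/differentiable_continuous/derivable1_diffP; have [] := de x.
have cF : continuous (fun x : R => - a^-1 * expR (- (a * x))).
  by move=> x; apply/differentiable_continuous/derivable1_diffP; have [] := dF x.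
rewrite (@ge0_continuous_FTC2y _ _ (fun x : R => - a^-1 * expR (- (a * x))) _ 0)//.
- by rewrite mulr0 oppr0 expR0 mulr1 EFinN oppeK add0e.
- exact: continuous_subspaceT.
- rewrite -[X in _ --> X](mulr0 (- a^-1)); apply: cvgM; first exact: cvg_cst.
  apply: (@cvg_comp _ _ _ (fun x => a * x) (fun z => expR (- z)) _ (pinfty_nbhs R)).
    exact: gt0_cvgMry.
  exact: cvgr_expR.
- by apply/cvg_at_right_filter; exact: cF.
- by move=> x _; rewrite derive1E; have [] := dF x.
Qed.

Lemma integrable_expRN (a : R) : 0 < a ->
  lam.-integrable `[0%R : R, +oo[ (EFin \o (fun x => expR (- (a * x)))).
Proof.
move=> a0; apply/integrableP; split.
  apply/measurable_EFinP; apply: measurable_funTS; apply: continuous_measurable_fun => x.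
  apply: (@continuous_comp _ _ _ (fun x => - (a * x)) expR); last exact: continuous_expR.
  by apply: cvgN; apply: cvgM; [exact: cvg_cst|exact: cvg_id].
under eq_integral do rewrite /= ger0_norm ?expR_ge0//.
by rewrite integral_expRN// ltry.
Qed.

Lemma expRN_abs_continuous (a : R) : continuous (fun x : R => expR (- (a * `|x|))).
Proof.
move=> x; apply: (@continuous_comp _ _ _ (fun x => - (a * `|x|)) expR).
  by apply: cvgN; apply: cvgM; [exact: cvg_cst|exact: norm_continuous].
exact: continuous_expR.
Qed.

Lemma integral_expRN_abs (a : R) : 0 < a ->
  (\int[lam]_x (expR (- (a * `|x|)))%:E = (2 / a)%:E)%E.
Proof.
move=> a0; rewrite ge0_symfun_integralT.
- rewrite EFinM -integral_expRN//; congr (_ * _)%E.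
  rewrite -set_itvcy; apply: eq_integral => x; rewrite inE /= in_itv /= andbT => x0.
  by rewrite ger0_norm.
- by move=> x; exact: expR_ge0.
- exact: expRN_abs_continuous.
- by move=> x /=; rewrite normrN.
Qed.

Lemma integrable_box_exp (N a M : R) : 0 < a ->
  (@lebesgue3 R).-integrable setT
    (fun x : R3 => (M * \1_(`[- N, N] `*` `[- N, N]) x.1 * expR (- (a * `|x.2|)))%:E).
Proof.
move=> a0; set B := `[- N, N] `*` `[- N, N].
have mB : measurable B by apply: measurableX; exact: measurable_itv.
have mh : measurable_fun setT (fun x : R3 => (M * \1_B x.1 * expR (- (a * `|x.2|)))%:E).
  apply/measurable_EFinP; apply: measurable_funM.
    apply: measurable_funM; first exact: measurable_cst.
    apply: (@measurableT_comp _ _ _ _ _ _ (\1_B : R * R -> R) _ fst).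
      exact: measurable_indic.
    exact: measurable_fst.
  apply: (@measurableT_comp _ _ _ _ _ _ (fun t : R => expR (- (a * `|t|))) _ snd).
    by apply: continuous_measurable_fun; exact: expRN_abs_continuous.
  exact: measurable_snd.
apply: (@integrable12ltyP _ _ _ _ _ (@lebesgue2 R) lam _ mh).2.
have E p : (\int[lam]_y `|(M * \1_B p * expR (- (a * `|y|)))%:E| =
    (`|M| * (2 / a))%:E * (\1_B p)%:E)%E.
  under eq_integral => y _.
    rewrite /= normrM (ger0_norm (expR_ge0 _)) EFinM; over.
  rewrite ge0_integralZl//=; last first.
    apply/measurable_EFinP; apply: continuous_measurable_fun.
    exact: expRN_abs_continuous.
  rewrite integral_expRN_abs// -!EFinM normrM; congr EFin.
  by rewrite (ger0_norm (_ : 0 <= \1_B p))//; ring.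
under eq_integral do rewrite E.
rewrite ge0_integralZl//=; last 2 first.
- by apply/measurable_EFinP; exact: measurable_indic.
- by rewrite lee_fin mulr_ge0// divr_ge0// ltW.
rewrite integral_indic// setIT.
pose I : set R := `[- N, N]%classic.
have lB : @lebesgue2 R B = (lam I * lam I)%E by rewrite /lebesgue2 product_measure1E.
rewrite [X in (_ * X)%E](_ : _ = (lam I * lam I)%E)//.
rewrite /I !lebesgue_measure_itv /=; case: ifP => _; by rewrite -?EFinD -!EFinM ltry.
Qed.

Local Notation mR3 := (measurableTypeR R * measurableTypeR R * measurableTypeR R)%type.

(** The line as a field and the line as the carrier of Lebesgue measure have
    convertible sigma-algebras under different displays; this lemma and the
    next pass from one to the other. *)
Lemma measurable3E (U : set R3) : measurable U = measurable (U : set mR3).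
Proof. by []. Qed.

Lemma measurable_fun3E (U : set R3) (f : R3 -> R) :
  measurable_fun U f = measurable_fun (U : set mR3) (f : mR3 -> R).
Proof. by []. Qed.

Lemma integrable_box_dominated (U : set R3) (f : R3 -> R) (N a M : R) : 0 < a ->
  measurable U -> measurable_fun U f ->
  (forall x, U x -> `|f x| <= M * \1_(`[- N, N] `*` `[- N, N]) x.1 * expR (- (a * `|x.2|))) ->
  (@lebesgue3 R).-integrable U (EFin \o f).
Proof.
move=> a0; rewrite measurable3E measurable_fun3E => mU mf fM.
have i1 := integrableS measurableT mU (@subsetT _ _) (integrable_box_exp N M a0).
apply: le_integrable i1 => //; first exact/measurable_EFinP.
by move=> x Ux; rewrite /= lee_fin (le_trans (fM x Ux))// ler_norm.
Qed.

End Measure.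

(** * Integrals of vertical derivatives *)

Section Vertical_integral.
Variables (R : realType) (Sigma : set (R * R)).
Local Notation R3 := (R * R * R)%type.
Local Notation lam := (@lebesgue_measure R).
Let Omega : set R3 := Sigma `*` [set: R].
Hypothesis oS : open Sigma.

Definition supp_in (K : set R3) (f : R3 -> R) := forall x, Omega x -> ~ K x -> f x = 0.

Lemma compact_box (K : set R3) : compact K -> exists2 N : R, 0 < N &
  forall x i, K x -> `|crd i x| <= N.
Proof.
move=> /compact_bounded; rewrite /bounded_set /= => -[M [Mr MP]].
exists (`|M| + 1) => [|x i Kx]; first by rewrite ltr_wpDl.
have /(MP _) /(_ x Kx) : M < `|M| + 1 by rewrite (le_lt_trans (ler_norm _))// ltrDl.
move=> /=; rewrite prod_normE /= ge_max prod_normE /= ge_max => /andP[/andP[h1 h2] h3].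
by case: i => [[|[|[|//]]] ?]; rewrite /crd /=.
Qed.

(** As K is closed, f vanishes near every point of Omega outside K. *)
Lemma supp_in_partial K f i : compact K -> supp_in K f -> supp_in K (partial i f).
Proof.
move=> cK fK x Ox Kx.
have oK : open (~` K).
  apply: closed_openC; exact: compact_closed.
rewrite /partial (@near_eq_derive _ _ _ _ (fun=> 0)) ?derive_cst//.
near=> y; apply: fK; near: y; apply: open_nbhs_nbhs; split => //.
exact: cylinder_open.
Unshelve. all: by end_near. Qed.

Lemma supp_in_integrable K f : compact K -> K `<=` Omega -> supp_in K f ->
  (forall x, Omega x -> {for x, continuous f}) ->
  (@lebesgue3 R).-integrable Omega (EFin \o f).
Proof.
move=> cK KO fK cf.
have oO : open Omega by exact: cylinder_open.
have [N N0 NP] := compact_box cK.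
have [M M0 MP] := @compact_cont_bounded _ _ f K cK (fun x Kx => cf x (KO x Kx)).
apply: (@integrable_box_dominated _ _ _ N 1 (M * expR N)) => //.
- exact: open_measurable3.
- exact: cont_measurable3.
move=> x Ox; have [Kx|Kx] := pselect (K x); last first.
  by rewrite fK// normr0 !mulr_ge0// expR_ge0.
have Bx : x.1 \in `[- N, N] `*` `[- N, N].
  rewrite inE; split; rewrite /= in_itv /= -ler_norml.
    exact: (NP x ord0).
  exact: (NP x (lift ord0 ord0)).
rewrite indicE Bx mulr1 mul1r -mulrA -expRD (le_trans (MP x Kx))//.
rewrite ler_peMr// -expR0 ler_expR subr_ge0; exact: (NP x ord_max).
Qed.

(** By Fubini the vertical integral may be taken first; on each line it
    vanishes by the fundamental theorem of calculus, since F is zero at both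
    ends of a long enough segment. *)
Lemma integral_vderiv0 K F : compact K -> K `<=` Omega -> supp_in K F ->
  (forall x, Omega x -> derivable F x (coord_vec ord_max)) ->
  (forall x, Omega x -> {for x, continuous (partial ord_max F)}) ->
  (\int[@lebesgue3 R]_(x in Omega) (partial ord_max F x)%:E = 0)%E.
Proof.
move=> cK KO FK dF cD.
have oO : open Omega by exact: cylinder_open.
have mO : measurable (Omega : set (measurableTypeR R * measurableTypeR R * measurableTypeR R)%type).
  exact: open_measurable3.
have iD := supp_in_integrable cK KO (supp_in_partial ord_max cK FK) cD.
rewrite integral_mkcond.
have iDT : (@lebesgue3 R).-integrable setT ((EFin \o partial ord_max F) \_ Omega).
  by apply/(integrable_mkcond _ mO).
rewrite -(@integral12_prod_meas1 _ _ _ _ _ (@lebesgue2 R) lam _ iDT).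
apply: integral0_eq => p _; rewrite /fubini_F.
have [Sp|nSp] := pselect (Sigma p); last first.
  by apply: integral0_eq => t _; rewrite patchE ifF// memNset// => -[].
have O t : Omega (p, t) by split.
have [N N0 NP] := compact_box cK.
have KN t : N < `|t| -> ~ K (p, t).
  by move=> Nt Kt; have := NP _ ord_max Kt; rewrite leNgt /crd /= Nt.
have -> : (fun t : R => ((EFin \o partial ord_max F) \_ Omega) (p, t)) =
    (fun t => (partial ord_max F (p, t))%:E) \_ `[- (N + 1), N + 1].
  apply/funext => t; rewrite !patchE mem_set//=; case: ifPn => // /negP tN.
  rewrite (supp_in_partial _ cK FK)//; apply: KN.
  rewrite ltNge; apply/negP => tN'; apply: tN; rewrite inE /= in_itv /= -ler_norml.
  by rewrite (le_trans tN')// lerDl.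
rewrite -integral_mkcond.
have dv (t : R) : is_derive t 1 (fun s => F (p, s)) (partial ord_max F (p, t)).
  exact/is_derive_vline/dF.
have cF : continuous (fun s => F (p, s)).
  by move=> t; apply/differentiable_continuous/derivable1_diffP; have [] := dv t.
have cp : continuous (fun s : R => (p, s)).
  by move=> t; apply: (@cvg_pair _ _ _ (nbhs t) (nbhs p) (nbhs t)); [exact: cvg_cst|exact: cvg_id].
rewrite (@continuous_FTC2 _ _ (fun s => F (p, s))).
- rewrite !FK// ?subee//; apply: KN.
    by rewrite normrN (lt_le_trans _ (ler_norm _))// ltrDl.
  by rewrite (lt_le_trans _ (ler_norm _))// ltrDl.
- by rewrite gtrN// addr_gt0.
- apply: continuous_subspaceT => t.
  apply: (@continuous_comp _ _ _ (fun s : R => (p, s)) (partial ord_max F)).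
    exact: cp.
  exact: cD.
- split=> [t _| |]; first by have [] := dv t.
    by apply: cvg_at_right_filter; exact: cF.
  by apply: cvg_at_left_filter; exact: cF.
- by move=> t _; rewrite derive1E; have [] := dv t.
Qed.

End Vertical_integral.

(** * The resolvent of the vertical derivative *)

Section Lipschitz.
Variable R : realType.
Local Notation R3 := (R * R * R)%type.

Lemma ball_crdP (x y : R3) (e : R) : ball x e y <-> forall i, `|crd i x - crd i y| < e.
Proof.
split=> [[[]]|h].
  rewrite -!ball_normE /ball_ /= => h1 h2 h3 i.
  by case: i => [[|[|[|//]]] ?]; rewrite /crd /=.
split; [split|]; rewrite -ball_normE /ball_ /=.
- exact: (h ord0).
- exact: (h (lift ord0 ord0)).
- exact: (h ord_max).
Qed.

Lemma mvt_abs (phi dphi : R -> R) (h B : R) :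
  (forall s : R, `|s| <= `|h| -> is_derive s 1 phi (dphi s)) ->
  (forall s, `|s| <= `|h| -> `|dphi s| <= B) ->
  `|phi h - phi 0| <= B * `|h|.
Proof.
move=> dp bp.
have cp (a b : R) : (forall s, s \in `[a, b] -> `|s| <= `|h|) -> {within `[a, b], continuous phi}.
  move=> ab; apply: derivable_within_continuous => s /ab hs.
  by have [] := dp s hs.
have [h0|h0] := leP 0 h.
  have sub s : s \in `[0, h] -> `|s| <= `|h|.
    by rewrite in_itv /= => /andP[s0 sh]; rewrite !ger0_norm.
  have [s /sub hs ->] :=
    MVT_segment h0 (fun s hs => dp s (sub s (subset_itv_oo_cc hs))) (cp _ _ sub).
  by rewrite subr0 normrM ler_wpM2r// bp.
have sub s : s \in `[h, 0] -> `|s| <= `|h|.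
  by rewrite in_itv /= => /andP[s0 sh]; rewrite !ler0_norm ?(ltW h0)// lerN2.
have [s /sub hs E] :=
  MVT_segment (ltW h0) (fun s hs => dp s (sub s (subset_itv_oo_cc hs))) (cp _ _ sub).
by rewrite distrC E sub0r normrM normrN ler_wpM2r// bp.
Qed.

(** Go from x to y parallel to the axes: balls of the product are boxes, so
    the path does not leave the ball. *)
Lemma lipschitz_ball (f : R3 -> R) (x : R3) (e B : R) :
  (forall y i, ball x e y -> derivable f y (coord_vec i) /\ `|partial i f y| <= B) ->
  forall y, ball x e y -> `|f y - f x| <= B * \sum_(i < 3) `|crd i y - crd i x|.
Proof.
move=> fB y /ball_crdP xy.
have crdE (z w : R3) : (forall i, crd i z = crd i w) -> z = w.
  case: z w => [[z1 z2] z3] [[w1 w2] w3] h.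
  by rewrite (h ord0 : z1 = w1) (h (lift ord0 ord0) : z2 = w2) (h ord_max : z3 = w3).
have step (z : R3) i : (forall j, crd j z = crd j x \/ crd j z = crd j y) -> crd i z = crd i x ->
   `|f (z + (crd i y - crd i x) *: coord_vec i) - f z| <= B * `|crd i y - crd i x|.
  move=> zxy zi; set h := crd i y - crd i x.
  have inb s : `|s| <= `|h| -> ball x e (z + s *: coord_vec i).
    move=> sh; have e0 : 0 < e by apply: le_lt_trans (xy i); rewrite normr_ge0.
    apply/ball_crdP => j; rewrite crd_line.
    have [<-|ij] := eqVneq i j.
      rewrite zi mulr1 opprD addNKr normrN (le_lt_trans sh)//.
      by rewrite /h distrC; exact: xy.
    by rewrite mulr0 addr0; case: (zxy j) => ->; rewrite ?subrr ?normr0.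
  have := @mvt_abs (fun s => f (z + s *: coord_vec i))
    (fun s => partial i f (z + s *: coord_vec i)) h B.
  rewrite scale0r addr0; apply=> s /inb zs; last by have [] := fB _ i zs.
  by apply: is_derive_line; have [] := fB _ i zs.
pose z1 := x + (crd ord0 y - crd ord0 x) *: coord_vec ord0.
pose i1 : 'I_3 := lift ord0 ord0.
pose z2 := z1 + (crd i1 y - crd i1 x) *: coord_vec i1.
have ye : y = z2 + (crd ord_max y - crd ord_max x) *: coord_vec ord_max.
  apply: crdE => j; rewrite !crd_line.
  by case: j => [[|[|[|//]]] ?]; rewrite /= ?mulr0 ?mulr1 ?addr0 addrC subrK;
    congr crd; apply/val_inj.
have s1 := step x ord0 (fun j => or_introl erefl) erefl.
have s2 : `|f z2 - f z1| <= B * `|crd i1 y - crd i1 x|.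
  apply: step => [j|]; rewrite /z1 crd_line; last by rewrite /= mulr0 addr0.
  have [<-|ij] := eqVneq ord0 j; first by right; rewrite mulr1 addrC subrK.
  by left; rewrite mulr0 addr0.
have s3 : `|f y - f z2| <= B * `|crd ord_max y - crd ord_max x|.
  rewrite {1}ye; apply: step => [j|]; rewrite /z2 /z1 !crd_line; last by rewrite /= !mulr0 !addr0.
  have [<-|ij] := eqVneq ord0 j; first by right; rewrite /= mulr0 addr0 mulr1 addrC subrK.
  have [<-|ij'] := eqVneq i1 j; first by right; rewrite /= mulr0 addr0 mulr1 addrC subrK.
  by left; rewrite !mulr0 !addr0.
rewrite !big_ord_recl big_ord0 addr0 !mulrDr.
have -> : f y - f x = (f z1 - f x) + ((f z2 - f z1) + (f y - f z2)) by ring.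
apply: (le_trans (ler_normD _ _)); apply: lerD => //.
apply: (le_trans (ler_normD _ _)); apply: lerD => //.
Qed.

(** Supplies the joint continuity of the integrals below, whose partial
    derivatives are obtained one axis at a time. *)
Lemma continuous_bounded_partials (f : R3 -> R) (x : R3) (e B : R) : 0 < e ->
  (forall y i, ball x e y -> derivable f y (coord_vec i) /\ `|partial i f y| <= B) ->
  {for x, continuous f}.
Proof.
move=> e0 fB; have L := lipschitz_ball fB.
have B0 : 0 <= B.
  by have [_] := fB x ord0 (ballxx _ e0); apply: le_trans.
apply/cvgrPdist_lt => d d0.
pose r := Num.min e (d / (3 * B + 1)).
have B1 : 0 < 3 * B + 1 by rewrite ltr_wpDl// mulr_ge0.
have r0 : 0 < r by rewrite lt_min e0 divr_gt0.
near=> y.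
have xy : ball x r y by near: y; apply: (nbhsx_ballx x r r0).
rewrite distrC; apply: le_lt_trans (L y _) _.
  by apply: le_ball xy; rewrite ge_min lexx.
have := xy => /ball_crdP xy3.
apply: (le_lt_trans (y := B * (3 * r))).
  rewrite ler_wpM2l// (le_trans (y := \sum_(i < 3) r))//.
    by apply: ler_sum => i _; rewrite distrC ltW.
  by rewrite sumr_const card_ord mulr_natl.
have : r <= d / (3 * B + 1) by rewrite ge_min lexx orbT.
rewrite ler_pdivlMr// => h; nra.
Unshelve. all: by end_near. Qed.

End Lipschitz.

Section Resolvent.
Variables (R : realType) (Sigma : set (R * R)) (eta : R).
Local Notation R3 := (R * R * R)%type.
Local Notation lam := (@lebesgue_measure R).
Let Omega : set R3 := Sigma `*` [set: R].
Hypothesis oS : open Sigma.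
Let oO : open Omega := cylinder_open oS.

Definition shift3 (x : R3) (r : R) : R3 := (x.1, x.2 - eta * r).

(** The Laplace transform at 1 of the translation semigroup generated by - eta
    d_3. *)
Definition resolvent (f : R3 -> R) (x : R3) : R :=
  (\int[lam]_(r in `[0%R, +oo[) (expR (- r) * f (shift3 x r)))%R.

Definition csmooth (f : R3 -> R) :=
  smooth Omega f /\ exists2 K, compact K & K `<=` Omega /\ supp_in Sigma K f.

Lemma csmooth_partial f i : csmooth f -> csmooth (partial i f).
Proof.
move=> [sf [K cK [KO fK]]]; split; first exact: smooth_partial.
by exists K => //; split=> //; exact: supp_in_partial.
Qed.

Lemma csmooth_bounded f : csmooth f -> exists2 B : R, 0 <= B & forall x, Omega x -> `|f x| <= B.
Proof.
move=> [sf [K cK [KO fK]]].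
have [B B0 BP] := compact_cont_bounded cK (fun x Kx => smooth_cont sf (KO x Kx)).
exists B => // x Ox; have [/BP//|Kx] := pselect (K x).
by rewrite fK// normr0.
Qed.

Lemma shift3_Omega x r : Omega x -> Omega (shift3 x r).
Proof. by case. Qed.

Lemma is_derive_shift f x (r : R) : smooth Omega f -> Omega x ->
  is_derive r 1 (fun r => f (shift3 x r)) (- eta * partial ord_max f (shift3 x r)).
Proof.
move=> sf Ox.
have dl : is_derive r 1 (fun r => x.2 - eta * r) (- eta).
  apply: is_derive_eq; rewrite /GRing.scale /=; ring.
have df : is_derive (x.2 - eta * r) 1 (fun t => f (x.1, t)) (partial ord_max f (shift3 x r)).
  apply: is_derive_vline; apply: smooth_derivable sf _; exact: (shift3_Omega r Ox).
have := @is_derive1_comp R (fun t => f (x.1, t)) _ r _ _ df dl.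
by rewrite mulrC.
Qed.

Lemma cont_shift f x : smooth Omega f -> Omega x ->
  continuous (fun r => expR (- r) * f (shift3 x r)).
Proof.
move=> sf Ox r; apply: cvgM.
  apply: (@continuous_comp _ _ _ (fun r : R => - r) expR); last exact: continuous_expR.
  by apply: cvgN; exact: cvg_id.
apply/differentiable_continuous/derivable1_diffP.
by have [] := is_derive_shift r sf Ox.
Qed.

Lemma resolvent_integrable_dom (h : R -> R) (B a : R) : 0 < a -> continuous h ->
  (forall r, 0 <= r -> `|h r| <= B * expR (- (a * r))) ->
  lam.-integrable `[0%R, +oo[ (EFin \o h).
Proof.
move=> a0 ch hB.
have m0 : measurable (`[0%R, +oo[%classic : set (measurableTypeR R)) by exact: measurable_itv.
have i1 := integrableZl m0 B (integrable_expRN a0).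
apply: (le_integrable m0) i1.
  by apply/measurable_EFinP; apply: measurable_funTS; exact: continuous_measurable_fun.
move=> r; rewrite /= in_itv /= andbT => r0; rewrite lee_fin (le_trans (hB r r0))//.
by rewrite ler_norm.
Qed.

Lemma resolvent_integrable f x : csmooth f -> Omega x ->
  lam.-integrable `[0%R, +oo[ (EFin \o (fun r => expR (- r) * f (shift3 x r))).
Proof.
move=> cf Ox; have [B B0 BP] := csmooth_bounded cf.
apply: (resolvent_integrable_dom (B := B) ltr01); first by apply: cont_shift => //; case: cf.
move=> r r0; rewrite mul1r normrM ger0_norm ?expR_ge0// mulrC ler_wpM2r ?expR_ge0//.
exact/BP/shift3_Omega.
Qed.

Lemma Rintegral_expRN (a : R) : 0 < a ->
  (\int[lam]_(r in `[0%R, +oo[) expR (- (a * r)))%R = a^-1.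
Proof. by move=> a0; rewrite /Rintegral integral_expRN. Qed.

Lemma resolvent_norm_dom f x (B a : R) : csmooth f -> Omega x -> 0 < a ->
  (forall r, 0 <= r -> `|expR (- r) * f (shift3 x r)| <= B * expR (- (a * r))) ->
  `|resolvent f x| <= B / a.
Proof.
move=> cf Ox a0 fB.
have m0 : measurable (`[0%R, +oo[%classic : set (measurableTypeR R)) by exact: measurable_itv.
have ir := resolvent_integrable cf Ox.
apply: (le_trans (le_normr_Rintegral m0 ir)).
rewrite -(Rintegral_expRN a0) -RintegralZl//; last exact: integrable_expRN.
apply: le_Rintegral => //.
- exact: integrable_norm.
- exact: (integrableZl m0 B (integrable_expRN a0)).
- by move=> r; rewrite /= in_itv /= andbT => r0; exact: fB.
Qed.

Lemma resolvent_bounded f : csmooth f ->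
  exists2 B : R, 0 <= B & forall x, Omega x -> `|resolvent f x| <= B.
Proof.
move=> cf; have [B B0 BP] := csmooth_bounded cf; exists B => // x Ox.
rewrite -[B]divr1; apply: resolvent_norm_dom => // r r0.
rewrite mul1r normrM ger0_norm ?expR_ge0// mulrC ler_wpM2r ?expR_ge0//.
exact/BP/shift3_Omega.
Qed.

(** Differentiation under the integral sign: f has bounded partial
    derivatives, and vertical translations preserve Omega, so B exp (-r)
    dominates. *)
Lemma is_derive_resolvent f x i : csmooth f -> Omega x ->
  is_derive x (coord_vec i) (resolvent f) (resolvent (partial i f) x).
Proof.
move=> cf Ox; have [sf _] := cf.
have [e /= e0 eO] := (nbhs_ballP _ _).1 (open_nbhs_nbhs (conj oO Ox)).
have inO (h : R) : h \in `]- e, e[ -> Omega (x + h *: coord_vec i).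
  rewrite in_itv /= -ltr_norml => he; apply: eO; apply/ball_crdP => j.
  rewrite crd_line opprD addNKr normrN normrM (le_lt_trans _ he)//.
  by rewrite ler_piMr//; case: (_ == _); rewrite ?normr1 ?normr0.
have shE (h r : R) : shift3 (x + h *: coord_vec i) r = shift3 x r + h *: coord_vec i.
  by rewrite /shift3 /=; apply/pair_equal_spec; split => //=; rewrite addrAC.
pose F (h r : R) := expR (- r) * f (shift3 (x + h *: coord_vec i) r).
have dF (h r : R) : h \in `]- e, e[ ->
    is_derive h 1 (F^~ r) (expR (- r) * partial i f (shift3 (x + h *: coord_vec i) r)).
  move=> he; have Oh := shift3_Omega r (inO h he); rewrite shE in Oh.
  have dl := is_derive_line (smooth_derivable (i := i) sf Oh).
  have -> : F^~ r = expR (- r) *: (fun s => f (shift3 x r + s *: coord_vec i)).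
    by apply/funext => s; rewrite /F shE.
  by rewrite shE; exact: is_deriveZ.
have [B B0 BP] := csmooth_bounded (csmooth_partial i cf).
have m0 : measurable (`[0%R, +oo[%classic : set (measurableTypeR R)) by exact: measurable_itv.
have I0 : `]- e, e[%classic (0 : R) by rewrite /= in_itv /= oppr_lt0 e0.
have hA h : `]- e, e[%classic h -> lam.-integrable `[0%R, +oo[ (EFin \o F h).
  by move=> he; apply: resolvent_integrable => //; exact: inO.
have hB (h r : R) : `]- e, e[%classic h -> `[0%R, +oo[%classic r -> derivable (F^~ r) h 1.
  by move=> he _; have [] := dF h r he.
have hC (r : R) : 0 <= B * expR (- (1 * r)) by rewrite mulr_ge0// expR_ge0.
have hD := integrableZl m0 B (integrable_expRN ltr01).
have hE (h r : R) : `]- e, e[%classic h -> `[0%R, +oo[%classic r ->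
    `|partial1of2 F h r| <= B * expR (- (1 * r)).
  move=> he _; rewrite partial1of2E; have [_ ->] := dF h r he.
  rewrite mul1r normrM ger0_norm ?expR_ge0// mulrC ler_wpM2r ?expR_ge0//.
  by apply/BP/shift3_Omega/inO.
have := @cvg_differentiation_under_integral R _ _ lam F _ m0 0 (- e) e I0 hA hB
   (fun r => B * expR (- (1 * r))) hC hD hE.
have -> : (fun h : R => h^-1 *: (\int[lam]_(y in `[0%R, +oo[) F (h + 0) y -
      \int[lam]_(y in `[0%R, +oo[) F 0 y)) =
   (fun h => h^-1 *: (resolvent f (h *: coord_vec i + x) - resolvent f x)).
  apply/funext => h; congr (_ *: (_ - _)).
    by rewrite addr0 /resolvent [h *: _ + x]addrC.
  by rewrite /resolvent /F scale0r addr0.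
have -> : (\int[lam]_(y in `[0%R, +oo[) partial1of2 F 0 y)%R = resolvent (partial i f) x.
  rewrite /resolvent; apply: eq_Rintegral => r _; rewrite partial1of2E.
  by have [_ ->] := dF 0 r I0; rewrite scale0r addr0.
move=> cv; apply: DeriveDef; first by apply/cvg_ex; eexists; exact: cv.
exact: cvg_lim cv.
Qed.

Lemma partial_resolvent f x i : csmooth f -> Omega x ->
  partial i (resolvent f) x = resolvent (partial i f) x.
Proof. by move=> cf Ox; have [] := is_derive_resolvent i cf Ox. Qed.

Lemma resolvent_cont f x : csmooth f -> Omega x -> {for x, continuous (resolvent f)}.
Proof.
move=> cf Ox.
have [e /= e0 eO] := (nbhs_ballP _ _).1 (open_nbhs_nbhs (conj oO Ox)).
have /choice[B BP] : forall i, exists B : R,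
    0 <= B /\ forall y, Omega y -> `|resolvent (partial i f) y| <= B.
  by move=> i; have [B B0 BP] := resolvent_bounded (csmooth_partial i cf); exists B.
apply: (@continuous_bounded_partials _ _ _ e (\sum_i B i)) => // y i /eO Oy.
split; first by have [] := is_derive_resolvent i cf Oy.
rewrite partial_resolvent// (le_trans ((BP i).2 y Oy))// (bigD1 i)//= lerDl.
by apply: sumr_ge0 => j _; exact: (BP j).1.
Qed.

Lemma resolvent_smooth f : csmooth f -> smooth Omega (resolvent f).
Proof.
move=> cf; apply/smooth_Cn => n; elim: n f cf => [|n IH] f cf.
  by split=> // x; exact: resolvent_cont.
split=> [x|i]; first exact: resolvent_cont.
split=> [x Ox|]; first by have [] := is_derive_resolvent i cf Ox.
apply: Cn_ext (IH _ (csmooth_partial i cf)) => // x Ox.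
by rewrite partial_resolvent.
Qed.

(** The integrand exp (-r) (f + eta d_3 f) (x - eta r e3) is the derivative of
    - exp (-r) f (x - eta r e3), which goes from - f x to 0. *)
Lemma resolvent_eq f x : csmooth f -> Omega x ->
  resolvent f x + eta * partial ord_max (resolvent f) x = f x.
Proof.
move=> cf Ox; rewrite partial_resolvent//; have [sf _] := cf.
have cp := csmooth_partial ord_max cf; have [sp _] := cp.
have [B0 B00 B0P] := csmooth_bounded cf; have [B1 B10 B1P] := csmooth_bounded cp.
pose B := B0 + `|eta| * B1.
have m0 : measurable (`[0%R, +oo[%classic : set (measurableTypeR R)) by exact: measurable_itv.
pose G (r : R) := - (expR (- r) * (f (shift3 x r) + B)).
(* Adding B exp (-r) makes the integrand nonnegative, so that the fundamental
   theorem of calculus applies on the half-line. *)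
pose k (r : R) := expR (- r) * f (shift3 x r) +
  eta * (expR (- r) * partial ord_max f (shift3 x r)) + B * expR (- (1 * r)).
have dG (r : R) : is_derive r 1 G (k r).
  have dN : is_derive r 1 (fun r : R => - r) (- 1) by apply: is_derive_eq.
  have dE := @is_derive1_comp R expR _ r _ _ (is_derive_expR _) dN.
  have ds := is_derive_shift r sf Ox.
  have dM := is_deriveN (is_deriveM dE (is_deriveD ds (is_derive_cst B r 1))).
  apply: is_derive_eq dM _.
  by rewrite /k /GRing.scale /= !fctE /= mul1r; ring.
have ck : continuous k.
  move=> r; apply: cvgD.
    apply: cvgD; first exact: cont_shift.
    by apply: cvgM; [exact: cvg_cst|exact: cont_shift].
  apply: cvgM; first exact: cvg_cst.
  apply: (@continuous_comp _ _ _ (fun r : R => - (1 * r)) expR); last exact: continuous_expR.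
  by apply: cvgN; apply: cvgM; [exact: cvg_cst|exact: cvg_id].
have cG : continuous G.
  by move=> r; apply/differentiable_continuous/derivable1_diffP; have [] := dG r.
have k0 r : 0 <= k r.
  rewrite /k mul1r.
  have -> : forall a b c d e : R, a * b + e * (a * c) + d * a = a * (b + e * c + d).
    by move=> *; ring.
  rewrite mulr_ge0 ?expR_ge0//.
  have h0 := B0P _ (shift3_Omega r Ox); have h1 := B1P _ (shift3_Omega r Ox).
  have h2 : `|eta * partial ord_max f (shift3 x r)| <= `|eta| * B1 by rewrite normrM ler_wpM2l.
  move: h0 h2; rewrite !ler_norml /B => /andP[h0 _] /andP[h2 _]; lra.
have Gl : G r @[r --> +oo] --> 0.
  have lim (a : R) : a * expR (- r) @[r --> +oo] --> 0.
    by rewrite -[X in _ --> X](mulr0 a); apply: cvgM; [exact: cvg_cst|exact: cvgr_expR].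
  apply: (@squeeze_cvgr _ _ _ _ (fun r => - (B0 + B) * expR (- r))
    (fun r => (B0 + B) * expR (- r))) => //.
    near=> r; rewrite mulNr -ler_norml /G normrN normrM ger0_norm ?expR_ge0//.
    rewrite mulrC ler_wpM2r ?expR_ge0//.
    apply: (le_trans (ler_normD _ _)); apply: lerD; first exact/B0P/shift3_Omega.
    by rewrite ger0_norm// /B addr_ge0// mulr_ge0.
have := @Rintegral_ge0_continuous_FTC2y R k G 0 0 (fun r _ => k0 r) (continuous_subspaceT ck) Gl
   (fun r _ => @ex_derive _ _ _ _ _ _ _ (dG r)) (cvg_at_right_filter (cG 0)).
have dk : {in `]0%R, +oo[, derive1 G =1 k}.
  by move=> r _; rewrite derive1E; have [] := dG r.
move/(_ dk).
have i1 := resolvent_integrable cf Ox; have i2 := resolvent_integrable cp Ox.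
have i2' := integrableZl m0 eta i2.
have i3 := integrableZl m0 B (integrable_expRN (@ltr01 R)).
rewrite /k RintegralD//; last exact: (integrableD m0 i1 i2').
rewrite RintegralD// RintegralZl// RintegralZl//; last exact: integrable_expRN.
rewrite Rintegral_expRN// invr1 mulr1 /G oppr0 expR0 mul1r sub0r opprK.
have -> : shift3 x 0 = x by rewrite /shift3 mulr0 subr0 -surjective_pairing.
by rewrite -/(resolvent f x) -/(resolvent (partial ord_max f) x) => /addIr.
Unshelve. all: by end_near. Qed.

(** Where the integrand does not vanish, |x.2| <= N + |eta| r. Half of the
    factor exp (-r) therefore absorbs exp (l (|x.2| - N)), and the other half
    makes the integral converge. *)
Lemma resolvent_decay f K (l : R) :
  smooth Omega f -> compact K -> K `<=` Omega -> supp_in Sigma K f ->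
  0 <= l -> l * `|eta| <= 2^-1 -> exists2 M : R, 0 <= M & forall x, Omega x ->
   (~ (fst @` K) x.1 -> resolvent f x = 0) /\ `|resolvent f x| <= M * expR (- (l * `|x.2|)).
Proof.
move=> sf cK KO fK l0 leta; have cf : csmooth f by split => //; exists K.
have [B B0 BP] := csmooth_bounded cf.
have [N N0 NP] := compact_box cK.
exists (2 * (B * expR (l * N))); first by rewrite !mulr_ge0// expR_ge0.
move=> x Ox; split.
  move=> nK; rewrite /resolvent (@eq_Rintegral _ _ _ lam _ (fun=> 0)).
    by rewrite /Rintegral integral0.
  move=> r _; rewrite (fK _ (shift3_Omega r Ox)) ?mulr0// => Kr.
  by apply: nK; exists (shift3 x r).
have h0 : (0 : R) < 2^-1 by rewrite invr_gt0.
have -> : 2 * (B * expR (l * N)) * expR (- (l * `|x.2|)) =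
    (B * expR (l * N) * expR (- (l * `|x.2|))) / 2^-1.
  by rewrite invrK; ring.
apply: resolvent_norm_dom => // r r0.
rewrite normrM ger0_norm ?expR_ge0//.
have key : `|f (shift3 x r)| <= B * expR (l * N) * expR (- (l * `|x.2|)) * expR (2^-1 * r).
  have [Ks|Ks] := pselect (K (shift3 x r)); last first.
    by rewrite fK ?normr0 ?mulr_ge0 ?expR_ge0//; exact: shift3_Omega.
  apply: (le_trans (BP _ (shift3_Omega r Ox))).
  rewrite -!mulrA -!expRD ler_peMr// -[leLHS]expR0 ler_expR.
  have := NP _ ord_max Ks; rewrite /crd /= => h.
  have h2 : `|x.2| <= N + `|eta| * r.
    have -> : x.2 = (x.2 - eta * r) + eta * r by rewrite subrK.
    by rewrite (le_trans (ler_normD _ _))// lerD// normrM (ger0_norm r0).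
  have := ler_wpM2l l0 h2; have := ler_wpM2r r0 leta.
  rewrite mulrDr mulrA; lra.
rewrite mulrC (le_trans (ler_wpM2r (expR_ge0 _) key))//.
rewrite -[leLHS]mulrA -expRD (_ : 2^-1 * r + - r = - (2^-1 * r))//; by field.
Qed.

Lemma resolventZ f a x : csmooth f -> Omega x -> resolvent (fun y => a * f y) x = a * resolvent f x.
Proof.
move=> cf Ox; rewrite /resolvent -RintegralZl//; last exact: resolvent_integrable.
by apply: eq_Rintegral => r _; rewrite mulrCA.
Qed.

End Resolvent.

(** * Exponentially decaying forms *)

Section Growth.
Variables (R : realType) (Sigma : set (R * R)) (K : set (R * R)).
Local Notation R3 := (R * R * R)%type.
Let Omega : set R3 := Sigma `*` [set: R].

(** Rates add up under products ([growsM]), so the growth of an expression in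
    the metric can be read off its shape. *)
Definition grows (a : R) (f : R3 -> R) := exists2 M : R, 0 <= M &
  forall x, Omega x -> K x.1 -> `|f x| <= M * expR (a * `|x.2|).

Lemma growsW a b f : a <= b -> grows a f -> grows b f.
Proof.
move=> ab [M M0 fM]; exists M => // x Ox Kx; rewrite (le_trans (fM x Ox Kx))//.
by rewrite ler_wpM2l// ler_expR ler_wpM2r.
Qed.

Lemma grows_cst c : grows 0 (fun=> c).
Proof. by exists `|c| => // x _ _; rewrite mul0r expR0 mulr1. Qed.

Lemma growsM a b f g : grows a f -> grows b g -> grows (a + b) (fun x => f x * g x).
Proof.
move=> [M M0 fM] [N N0 gN]; exists (M * N); first exact: mulr_ge0.
move=> x Ox Kx; rewrite mulrDl expRD mulrACA normrM.
by rewrite ler_pM//; [exact: fM|exact: gN].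
Qed.

Lemma grows_sum (I : finType) a (f : I -> R3 -> R) :
  (forall i, grows a (f i)) -> grows a (fun x => \sum_i f i x).
Proof.
move=> /(_ _)/cid2 fM; exists (\sum_i projT1 (fM i)).
  by apply: sumr_ge0 => i _; case: (fM i).
move=> x Ox Kx; rewrite big_distrl /= (le_trans (ler_norm_sum _ _ _))//.
by apply: ler_sum => i _; case: (fM i) => M M0 /=; exact.
Qed.

Lemma grows_prod k a (f : 'I_k -> R3 -> R) :
  (forall i, grows a (f i)) -> grows (k%:R * a) (fun x => \prod_i f i x).
Proof.
elim: k f => [|k IH] f fM.
  rewrite mul0r; have [M M0 MP] := grows_cst 1; exists M => // x Ox Kx.
  by rewrite big_ord0 MP.
have := growsM (fM ord0) (IH _ (fun i => fM (lift ord0 i))).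
have -> : a + k%:R * a = k.+1%:R * a by rewrite -natr1 mulrDl mul1r addrC.
move=> [M M0 MP]; exists M => // x Ox Kx.
by rewrite big_ord_recl MP.
Qed.

End Growth.

Section Forms.
Variables (R : realType) (Sigma : set (R * R)) (g : R * R * R -> 'M[R]_3).
Local Notation R3 := (R * R * R)%type.
Local Notation mR3 := (measurableTypeR R * measurableTypeR R * measurableTypeR R)%type.
Let Omega : set R3 := Sigma `*` [set: R].
Hypotheses (oS : open Sigma) (gR : riemannian_metric Omega g).
Let oO : open Omega := cylinder_open oS.

Variables (K : set (R * R)) (c : R).
Hypotheses (cK : compact K) (KS : K `<=` Sigma) (c0 : 0 <= c).
Hypothesis gK : exists2 M : R, 0 <= M & forall p t, K p ->
    (forall i j, `|invmx (g (p, t)) i j| <= M * expR (c * `|t|)) /\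
    vol_density g (p, t) <= M * expR (3 * c * `|t|).

Definition decaying k (l : R) (u : kform R k) :=
  (forall x, Omega x -> alternating_cov (u x)) /\
  forall I, [/\ forall x, Omega x -> {for x, continuous (fun x => u x I)},
    forall x, Omega x -> ~ K x.1 -> u x I = 0 & grows Sigma K (- l) (fun x => u x I)].

Lemma grows_invmx i j : grows Sigma K c (fun x => invmx (g x) i j).
Proof.
have [M M0 MP] := gK; exists M => // -[p t] Ox Kp /=.
by have [+ _] := MP p t Kp; exact.
Qed.

Lemma grows_vol : grows Sigma K (3 * c) (vol_density g).
Proof.
have [M M0 MP] := gK; exists M => // -[p t] Ox Kp /=.
by rewrite ger0_norm ?sqrtr_ge0//; have [_] := MP p t Kp.
Qed.

Lemma grows_sharp k l (u : kform R k) I : decaying l u ->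
  grows Sigma K (k%:R * c - l) (fun x => sharp g x (u x) I).
Proof.
move=> [_ du]; apply: grows_sum => J; apply: growsM; last by have [] := du J.
by apply: grows_prod => m; exact: grows_invmx.
Qed.

Lemma cont_sharp k l (u : kform R k) I x : decaying l u -> Omega x ->
  {for x, continuous (fun x => sharp g x (u x) I)}.
Proof.
move=> [_ du] Ox; apply: cont_sum => J _; apply: cvgM; last by have [+ _ _] := du J; exact.
by apply: cont_prod => m _; exact: (invmetric_cont oO gR).
Qed.

Lemma sharp_eq0 k l (u : kform R k) I x : decaying l u -> Omega x -> ~ K x.1 ->
  sharp g x (u x) I = 0.
Proof.
move=> [_ du] Ox Kx; rewrite /sharp big1// => J _.
by have [_ dz _] := du J; rewrite dz ?mulr0.
Qed.

(** The star loses 3 c to the volume density and c to each of the at most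
    three indices that it raises. *)
Lemma decaying_hodge k k' l (u : kform R k) : (k + k')%N = 3 -> decaying l u ->
  decaying (l - 6 * c) (hodge g u : kform R k').
Proof.
move=> kk du; split=> [x Ox|J]; first exact: hodge_alternating.
split=> [x Ox|x Ox Kx|].
- apply: cvgM; first by apply: cvgM; [exact: cvg_cst|exact: (vol_density_cont gR)].
  apply: cont_sum => I _; apply: cvgM; first exact: cvg_cst.
  exact: cont_sharp du Ox.
- by rewrite /hodge big1 ?mulr0// => I _; rewrite (sharp_eq0 _ du)// mulr0.
have k3 : k%:R <= 3 :> R by rewrite ler_nat (leq_trans (leq_addr k' k))// kk.
apply: (@growsW _ _ _ (0 + 3 * c + (0 + (k%:R * c - l)))).
  have : k%:R * c <= 3 * c by rewrite ler_wpM2r.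
  lra.
apply: growsM; first by apply: growsM; [exact: grows_cst|exact: grows_vol].
apply: grows_sum => I; apply: growsM; first exact: grows_cst.
exact: grows_sharp.
Qed.

Lemma kformN k (u : kform R k) x I : (- u) x I = - u x I.
Proof. by []. Qed.

Lemma decayingN k l (u : kform R k) : decaying l u -> decaying l (- u).
Proof.
move=> [ua du]; split=> [x Ox s I|I].
  by rewrite !kformN ua// mulrN.
have [d1 d2 d3] := du I; split=> [x Ox|x Ox Kx|].
- by apply: cvgN; exact: d1.
- by rewrite kformN d2// oppr0.
- have [M M0 MP] := d3; exists M => // x Ox Kx.
  by rewrite kformN normrN MP.
Qed.

(** The squared norm has rate at most 6 c - 2 l <= -1: the inverse metric and
    the volume density cost 3 c each. Over the bounded set K this is
    integrable. *)
Lemma decaying_L2 k l (u : kform R k) : (k <= 3)%N -> 6 * c + 1 <= 2 * l ->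
  decaying l u -> L2 Omega g u.
Proof.
move=> k3 cl du; have [ua duI] := du; split=> //.
  by move=> I; apply: cont_measurable3 => //; have [+ _ _] := duI I; exact.
pose h x := covector_ip g x (u x) (u x) * vol_density g x.
have ch x : Omega x -> {for x, continuous h}.
  move=> Ox; apply: cvgM; last exact: (vol_density_cont gR).
  apply: cvgM; first exact: cvg_cst.
  apply: cont_sum => I _; apply: cvgM; first by have [+ _ _] := duI I; exact.
  exact: cont_sharp du Ox.
have mh : measurable_fun Omega h by exact: cont_measurable3.
have mO : measurable Omega by exact: open_measurable3.
have gh : grows Sigma K (-1) h.
  have k3' : k%:R <= 3 :> R by rewrite ler_nat.
  apply: (@growsW _ _ _ (0 + (- l + (k%:R * c - l)) + 3 * c)).
    have : k%:R * c <= 3 * c by rewrite ler_wpM2r.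
    lra.
  apply: growsM; last exact: grows_vol.
  apply: growsM; first exact: grows_cst.
  apply: grows_sum => I; apply: growsM; first by have [] := duI I.
  exact: grows_sharp.
have [M M0 MP] := gh.
(* [compact_box] is about sets of space, hence the factor [set 0]. *)
have cK0 : compact (K `*` [set (0 : R)]) by apply: compact_setX => //; exact: compact_set1.
have [N N0 NP] := compact_box cK0.
have ih : (@lebesgue3 R).-integrable Omega (EFin \o h).
  apply: (@integrable_box_dominated _ _ _ N 1 M) => // x Ox.
  have [Kx|Kx] := pselect (K x.1); last first.
    rewrite /h /covector_ip big1 ?mulr0 ?mul0r ?normr0; first by rewrite !mulr_ge0// expR_ge0.
    by move=> I _; have [_ dz _] := duI I; rewrite dz ?mul0r.
  have Bx : x.1 \in `[- N, N] `*` `[- N, N].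
    have K0 : (K `*` [set (0 : R)]) (x.1, 0) by [].
    rewrite inE; split; rewrite /= in_itv /= -ler_norml.
      exact: (NP (x.1, 0) ord0 K0).
    exact: (NP (x.1, 0) (lift ord0 ord0) K0).
  by rewrite indicE Bx mulr1 -mulNr; exact: MP.
have /integrableP[_] := ih.
apply: le_lt_trans; apply: (le_trans (lee_abs _)).
by apply: le_abse_integral => //; apply/measurable_EFinP; exact: mh.
Qed.

End Forms.

(** * Integration by parts against the Hodge star *)

Section Adjoint.
Variables (R : realType) (Sigma : set (R * R)) (g : R * R * R -> 'M[R]_3).
Local Notation R3 := (R * R * R)%type.
Local Notation mR3 := (measurableTypeR R * measurableTypeR R * measurableTypeR R)%type.
Let Omega : set R3 := Sigma `*` [set: R].
Hypotheses (oS : open Sigma) (gR : riemannian_metric Omega g).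
Let oO : open Omega := cylinder_open oS.

Lemma lie_der_e3 k (w : kform R k) x I :
  lie_der e3 w x I = partial ord_max (fun y => w y I) x.
Proof.
rewrite /lie_der [X in _ + X]big1 ?addr0 => [|m _]; last first.
  by rewrite big1// => j _; rewrite /partial derive_cst mul0r.
rewrite (bigD1 ord_max)//= big1 ?addr0 => [|j jm].
  by rewrite /e3 mxE !eqxx mul1r.
by rewrite /e3 mxE (negbTE jm) andbF mul0r.
Qed.

(** The coefficient of u /\ a in the coordinate volume form. *)
Definition wedge k l (a : kform R l) (u : kform R k) (x : R3) : R :=
  l`!%:R^-1 * k`!%:R^-1 * \sum_(I : l.-tuple 'I_3) \sum_(M : k.-tuple 'I_3)
     levi_civita R (M ++ I) * (a x I * u x M).

Lemma measurable_wedge k l (a : kform R l) (u : kform R k) :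
  (forall I, measurable_fun Omega (fun x => a x I)) ->
  (forall I, measurable_fun Omega (fun x => u x I)) ->
  measurable_fun Omega (wedge a u).
Proof.
move=> ma mu; apply: measurable_funM; first exact: measurable_cst.
apply: measurable_sum => I; apply: measurable_sum => M.
by apply: measurable_funM; [exact: measurable_cst|exact: measurable_funM].
Qed.

Lemma L2ip_hodge k l (a a' : kform R l) (u : kform R k) : (k + l)%N = 3 ->
  (forall I, measurable_fun Omega (fun x => a x I)) ->
  (forall I, measurable_fun Omega (fun x => a' x I)) ->
  (forall I, measurable_fun Omega (fun x => u x I)) ->
  L2eq Omega a a' ->
  L2ip Omega g a (hodge g u) = fine (\int[@lebesgue3 R]_(x in Omega) (wedge a' u x)%:E)%E.
Proof.
move=> kl ma ma' mu aa'.
have mO : measurable (Omega : set mR3) by exact: open_measurable3.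
transitivity (fine (\int[@lebesgue3 R]_(x in Omega) (wedge a u x)%:E)%E).
  congr fine; apply: eq_integral => x /set_mem Ox; congr EFin.
  rewrite covector_ip_hodge//; first exact: (metric_sym gR).
  exact: (metric_det_gt0 gR).
congr fine; apply: ae_eq_integral => //.
- by apply/measurable_EFinP; rewrite -measurable_fun3E; exact: measurable_wedge.
- by apply/measurable_EFinP; rewrite -measurable_fun3E; exact: measurable_wedge.
apply: filterS aa' => x /= aa' Ox; congr EFin.
by rewrite /wedge; congr (_ * _); apply: eq_bigr => I _; apply: eq_bigr => M _; rewrite aa'.
Qed.

(** The difference of the two integrands is the vertical derivative of [wedge
    a u], which is compactly supported because a is. *)
Lemma wedge_byparts k l (a : kform R l) (u f : kform R k) K : compact K -> K `<=` Omega ->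
  (forall I, smooth Omega (fun x => a x I)) -> (forall I, supp_in Sigma K (fun x => a x I)) ->
  (forall I, smooth Omega (fun x => u x I)) ->
  (forall I x, Omega x -> f x I = - partial ord_max (fun x => u x I) x) ->
  fine (\int[@lebesgue3 R]_(x in Omega) (wedge (lie_der e3 a) u x)%:E)%E =
  fine (\int[@lebesgue3 R]_(x in Omega) (wedge a f x)%:E)%E.
Proof.
move=> cK KO sa aK su uf.
pose F := wedge a u.
have sl I : smooth Omega (fun x => lie_der e3 a x I).
  by apply: smooth_ext (smooth_partial ord_max (sa I)) => // x _; rewrite lie_der_e3.
have sf I : smooth Omega (fun x => f x I).
  apply: smooth_ext (smoothM oO (smooth_cst (-1) oO) (smooth_partial ord_max (su I))) => // x Ox.
  by rewrite uf// mulN1r.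
have slK I : supp_in Sigma K (fun x => lie_der e3 a x I).
  by move=> x Ox Kx; rewrite lie_der_e3 (supp_in_partial oS ord_max cK (aK I)).
have cw (b : kform R l) (v : kform R k) : (forall I, smooth Omega (fun x => b x I)) ->
   (forall I, smooth Omega (fun x => v x I)) ->
   forall x, Omega x -> {for x, continuous (wedge b v)}.
  move=> sb sv x Ox; apply: cvgM; first exact: cvg_cst.
  apply: cont_sum => I _; apply: cont_sum => M _; apply: cvgM; first exact: cvg_cst.
  by apply: cvgM; [exact: (smooth_cont (sb I))|exact: (smooth_cont (sv M))].
have Kw (b : kform R l) (v : kform R k) : (forall I, supp_in Sigma K (fun x => b x I)) ->
    supp_in Sigma K (wedge b v).
  move=> bK x Ox Kx; rewrite /wedge big1 ?mulr0// => I _; rewrite big1// => M _.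
  by rewrite bK// mul0r mulr0.
have dF x : Omega x -> is_derive x (coord_vec ord_max) F (wedge (lie_der e3 a) u x - wedge a f x).
  move=> Ox.
  have dterm (I : l.-tuple 'I_3) (M : k.-tuple 'I_3) :
    is_derive x (coord_vec ord_max) (fun y => levi_civita R (M ++ I) * (a y I * u y M))
     (levi_civita R (M ++ I) * (lie_der e3 a x I * u x M) -
      levi_civita R (M ++ I) * (a x I * f x M)).
    have da := derivableP (smooth_derivable (i := ord_max) (sa I) Ox).
    have du := derivableP (smooth_derivable (i := ord_max) (su M) Ox).
    have dM := is_deriveZ (levi_civita R (M ++ I)) (is_deriveM da du).
    apply: is_derive_eq dM _.
    rewrite lie_der_e3 uf// /partial /GRing.scale /=; ring.
  have dZ := is_deriveZ (l`!%:R^-1 * k`!%:R^-1)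
    (is_derive_sumf (fun I => is_derive_sumf (fun M => dterm I M))).
  apply: is_derive_eq dZ _.
  rewrite /wedge -mulrBr /GRing.scale /= -sumrB; congr (_ * _).
  by apply: eq_bigr => I _; rewrite -sumrB.
have pF x : Omega x -> partial ord_max F x = wedge (lie_der e3 a) u x - wedge a f x.
  by move=> /dF[].
have i1 := supp_in_integrable oS cK KO (Kw _ u slK) (cw _ _ sl su).
have i2 := supp_in_integrable oS cK KO (Kw _ f aK) (cw _ _ sa sf).
have mO : measurable (Omega : set mR3) by exact: open_measurable3.
have cpF x : Omega x -> {for x, continuous (partial ord_max F)}.
  move=> Ox; rewrite /prop_for /continuous_at pF//.
  apply: cvg_trans (cvgB (cw _ _ sl su x Ox) (cw _ _ sa sf x Ox)).
  apply: near_eq_cvg; have := open_nbhs_nbhs (conj oO Ox).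
  by apply: filterS => y Oy; rewrite /= pF.
have := @integral_vderiv0 R Sigma oS K F cK KO (Kw _ u aK)
  (fun x Ox => @ex_derive _ _ _ _ _ _ _ (dF x Ox)) cpF.
rewrite (eq_integral
  (fun x : mR3 => (wedge (lie_der e3 a) u x)%:E - (wedge a f x)%:E)%E); last first.
  by move=> x /set_mem Ox; rewrite pF.
rewrite integralB//.
have f1 := integrable_fin_num mO i1; have f2 := integrable_fin_num mO i2.
rewrite -(fineK f1) -(fineK f2) -EFinB => -[/eqP].
by rewrite subr_eq0 => /eqP.
Qed.

End Adjoint.

(** * Solving u + eta L u = w *)

Section Solution.
Variables (R : realType) (Sigma : set (R * R)) (g : R * R * R -> 'M[R]_3).
Local Notation R3 := (R * R * R)%type.
Let Omega : set R3 := Sigma `*` [set: R].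
Hypotheses (oS : open Sigma) (gR : riemannian_metric Omega g).
Let oO : open Omega := cylinder_open oS.

Variables (eta : R) (k : nat).

Definition resolvent_form (w : kform R k) : kform R k :=
  fun x I => resolvent eta (fun y => w y I) x.

Definition d3_form (w : kform R k) : kform R k := fun x I => partial ord_max (fun y => w y I) x.

Lemma resolvent_form_alternating w x : (forall y, Omega y -> alternating_cov (w y)) ->
  (forall I, csmooth Sigma (fun y => w y I)) ->
  Omega x -> alternating_cov (resolvent_form w x).
Proof.
move=> wa cw Ox s I; rewrite /resolvent_form -(resolventZ _ _ (cw I) Ox) /resolvent.
apply: eq_Rintegral => r _; congr (_ * _); apply: wa; exact: shift3_Omega.
Qed.

Lemma d3_form_alternating w x : (forall y, Omega y -> alternating_cov (w y)) ->
  (forall I, smooth Omega (fun y => w y I)) ->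
  Omega x -> alternating_cov (d3_form w x).
Proof.
move=> wa sw Ox s I; rewrite /d3_form /partial.
rewrite (@near_eq_derive _ _ _ _ ((-1) ^+ s *: (fun y => w y I))).
  by rewrite deriveZ//; exact: smooth_derivable (sw I) Ox.
have := open_nbhs_nbhs (conj oO Ox).
by apply: filterS => y Oy; exact: wa.
Qed.

Variables (K : set R3) (w : kform R k).
Hypotheses (cK : compact K) (KO : K `<=` Omega) (k3 : (k <= 3)%N).
Hypothesis sw : smooth_form Omega k w.
Hypothesis wK : forall x, Omega x -> ~ K x -> w x = 0.

Let wKI I : supp_in Sigma K (fun y => w y I).
Proof. by move=> x Ox Kx; rewrite wK. Qed.

Let cw I : csmooth Sigma (fun y => w y I).
Proof. by split; [case: sw => + _; exact|exists K]. Qed.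

Let u := resolvent_form w.
Let f := d3_form u.

Lemma sol_smooth : smooth_form Omega k u.
Proof.
split=> [I|x Ox]; first exact: resolvent_smooth.
by apply: resolvent_form_alternating => // y; case: sw => _; exact.
Qed.

Lemma sol_eq x I : Omega x -> u x I + eta * f x I = w x I.
Proof. by move=> Ox; exact: (resolvent_eq eta oS (cw I) Ox). Qed.

Lemma d3_sol x I : Omega x -> f x I = resolvent eta (partial ord_max (fun y => w y I)) x.
Proof. by move=> Ox; exact: (partial_resolvent eta oS ord_max (cw I) Ox). Qed.

Lemma sol_decaying l : 0 <= l -> l * `|eta| <= 2^-1 -> decaying Sigma (fst @` K) l u.
Proof.
move=> l0 le; split=> [x|I]; first by have [_] := sol_smooth; exact.
have [M M0 MP] := resolvent_decay (cw I).1 cK KO (@wKI I) l0 le.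
split=> [x Ox|x Ox|]; first exact: (resolvent_cont oS (cw I) Ox).
  by have [+ _] := MP x Ox; exact.
by exists M => // x Ox _; rewrite mulNr; have [_] := MP x Ox.
Qed.

Lemma d3_sol_decaying l : 0 <= l -> l * `|eta| <= 2^-1 -> decaying Sigma (fst @` K) l f.
Proof.
move=> l0 le; have [su ua] := sol_smooth; split=> [x Ox|I].
  exact: d3_form_alternating.
have cp := csmooth_partial oS ord_max (cw I).
have [M M0 MP] := resolvent_decay cp.1 cK KO (supp_in_partial oS ord_max cK (@wKI I)) l0 le.
split=> [x Ox|x Ox Kx|].
- exact/smooth_cont/Ox/smooth_partial/su.
- by rewrite d3_sol//; have [+ _] := MP x Ox; exact.
- exists M => // x Ox _; rewrite mulNr d3_sol//; by have [_] := MP x Ox.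
Qed.

Variable c : R.
Hypotheses (c0 : 0 <= c) (small : (9 * c + 1) * `|eta| <= 2^-1).
Hypothesis gK : exists2 M : R, 0 <= M & forall p t, (fst @` K) p ->
    (forall i j, `|invmx (g (p, t)) i j| <= M * expR (c * `|t|)) /\
    vol_density g (p, t) <= M * expR (3 * c * `|t|).

Let KS : fst @` K `<=` Sigma.
Proof. by move=> _ [x /KO[? _] <-]. Qed.

Let cK1 : compact (fst @` K).
Proof. exact: compact_fst. Qed.

(** For a test form phi, the pairing of L phi with *u is the integral of u /\
    L phi, and integrating by parts turns it into the pairing of phi with *(-
    L u). The rate 9 c + 1 leaves 3 c + 1 after the loss of 6 c in the star,
    more than the 3 c + 1 / 2 that [decaying_L2] asks for. *)
Lemma sol_lie : lie Omega g k e3 u f.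
Proof.
have l0 : 0 <= 9 * c + 1 by rewrite addr_ge0// mulr_ge0.
have du := sol_decaying l0 small; have df := d3_sol_decaying l0 small.
have kk : (k + (3 - k))%N = 3 by rewrite subnKC.
have kk' : (3 - k + k)%N = 3 by rewrite subnK.
have L k' (v : kform R k') : (k' <= 3)%N ->
    decaying Sigma (fst @` K) (9 * c + 1 - 6 * c) v -> L2 Omega g v.
  by move=> k3'; apply: (decaying_L2 oS gR cK1 c0 gK) => //; lra.
have L' (v : kform R k) : decaying Sigma (fst @` K) (9 * c + 1) v -> L2 Omega g v.
  by apply: (decaying_L2 oS gR cK1 c0 gK) => //; move: c0; lra.
have Hu := decaying_hodge oS gR c0 gK kk du.
have Hf := decaying_hodge oS gR c0 gK kk (decayingN df).
split; [exact: L'|exact: L'|].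
exists (hodge g (- f) : kform R (3 - k)); last first.
  apply: aeW => x Ox; apply/funext => J; rewrite kformN hodge_hodge ?kformN ?opprK//.
  - exact: (metric_sym gR).
  - exact: (metric_det_gt0 gR).
  - by case: (decayingN df) => + _; exact.
split; first exact: (L _ _ (leq_subr _ _) Hu).
  exact: (L _ _ (leq_subr _ _) Hf).
move=> phi' psi' [Lphi Lpsi [phi [sphi [K' [cK' KO' phiK]]] [e1 e2]]].
have mcont (a : R3 -> R) : (forall x, Omega x -> {for x, continuous a}) -> measurable_fun Omega a.
  exact: cont_measurable3.
have mu I : measurable_fun Omega (fun x => u x I).
  by apply: mcont; case: du => _ /(_ I)[].
have mf I : measurable_fun Omega (fun x => (- f) x I).
  by apply: mcont; case: (decayingN df) => _ /(_ I)[].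
have mphi I : measurable_fun Omega (fun x => phi x I).
  by apply: mcont => x; apply: smooth_cont; case: sphi => + _; exact.
have mpsi I : measurable_fun Omega (fun x => lie_der e3 phi x I).
  apply: mcont => x.
  have -> : (fun x => lie_der e3 phi x I) = partial ord_max (fun y => phi y I).
    by apply/funext => y; rewrite lie_der_e3.
  by apply: smooth_cont; apply: smooth_partial; case: sphi => + _; exact.
rewrite (L2ip_hodge oS gR kk _ mpsi mu e2); last by case: Lpsi.
rewrite (L2ip_hodge oS gR kk _ mphi mf e1); last by case: Lphi.
apply: (wedge_byparts oS cK' KO') => //.
- by case: sphi.
- by move=> I x Ox Kx; rewrite phiK.
- by case: sol_smooth.
Qed.

End Solution.

Lemma L2norm_sub0 (R : realType) (Omega : set (R * R * R)) g k (u : kform R k) :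
  L2norm Omega g (u - u) = 0.
Proof.
rewrite subrr /L2norm /L2ip /Rintegral integral0_eq ?sqrtr0// => x _.
by rewrite /covector_ip big1 ?mulr0 ?mul0r// => I _; rewrite [X in X * _]/= mul0r.
Qed.

Lemma d_c_d_ring (R : realType) (Omega : set (R * R * R)) g k (u : kform R k) f :
  d_c Omega g k u f -> d_ring Omega g k u f.
Proof.
move=> duf; have [Lu Lf _] := duf; split=> // eps e0; exists u, f; split=> //.
by rewrite /graph_norm !L2norm_sub0 expr0n addr0 sqrtr0.
Qed.

Theorem proposition4p14 (R : realType) (Sigma : set (R * R))
    (g : R * R * R -> 'M[R]_3) (k : nat) :
  let Omega : set (R * R * R) := Sigma `*` [set: R] in
  open Sigma ->
  riemannian_metric Omega g ->
  (ereal_sup [set supnorm Omega g (cov_der g Y e3) | Y in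
     [set Y : vfield | [/\ smooth_vfield Omega Y, csupport_in Omega Y &
                           (supnorm Omega g Y <= 1)%E]]] < +oo)%E ->
  (k <= 3)%N ->
  exists2 eta0 : R, 0 < eta0 & forall eta : R, `|eta| < eta0 ->
    dense_in_dom Omega g (d_ring Omega g k)
      (one_plus_image Omega g eta (lie Omega g k e3)
         (smooth_form Omega k `&` op_dom (lie Omega g k e3))
       `&` op_dom (d_ring Omega g k)).
Proof.
move=> Omega oS gR bnd k3.
have [c c0 cP] := metric_growth oS gR bnd.
have l0 : 0 < 9 * c + 1 by rewrite ltr_wpDl// mulr_ge0.
exists (2^-1 / (9 * c + 1)); first by rewrite divr_gt0// invr_gt0.
move=> eta; rewrite ltr_pdivlMr// mulrC => /ltW small.
split=> [v [_ //]|u f [Lu Lf dense] eps e0].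
have [v [h [dvh uv]]] := dense _ e0.
exists v, h; split=> //; last exact: d_c_d_ring.
split; last by exists h; exact: d_c_d_ring.
have [Lv Lh [w [sw [K [cK KO wK]]] [vw _]]] := dvh.
(* The approximating form itself is in the image: it agrees almost everywhere
   with w, and w = u + eta L u for the resolvent u of w. *)
have gK : exists2 M : R, 0 <= M & forall p t, (fst @` K) p ->
    (forall i j, `|invmx (g (p, t)) i j| <= M * expR (c * `|t|)) /\
    vol_density g (p, t) <= M * expR (3 * c * `|t|).
  by apply: cP; [exact: compact_fst|move=> _ [x /KO[? _] <-]].
have Luf := sol_lie oS gR cK KO k3 sw wK c0 small gK.
split=> //; exists (resolvent_form eta w), (d3_form (resolvent_form eta w)); split=> //.
  split; first exact: (sol_smooth oS eta cK KO sw wK).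
  by exists (d3_form (resolvent_form eta w)).
apply: filterS vw => x vw Ox; rewrite vw//; apply/funext => I.
by rewrite -(sol_eq oS eta cK KO sw wK I Ox).
Qed.
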